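(* Let $k$ be a field with $\operatorname{char}(k)\neq 5$ and let $c\in k$ satisfy $c^2+c=1$. Let $S=k[x_1,x_2,\ldots]$, the polynomials $g_n\in S$ ($n\ge 2$), the ideal $I=(g_n\mid n\in D)\subseteq S$, the graded polynomial algebra $T=k[y_n\mid n\in A]$, and the monomial order $\preceq$ on $S$ be as defined in the context. Then: (1) The canonical $k$-algebra homomorphism $$\theta:T\longrightarrow S/I,\qquad y_n\longmapsto \overline{x_n}\quad(n\in A),$$ is an isomorphism of graded $k$-algebras. (2) With respect to the monomial order $\preceq$, the set $$\mathcal G=\{g_{2m}\mid m\ge 1\}\cup\{c^{-1}g_{2m+1}\mid m\ge 1\}$$ is the reduced Gröbner basis of $I$. (3) Consequently, $$\operatorname{in}(I)=(x_m^2,\ x_mx_{m+1}\mid m\ge 1).$$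
   Context: $S=k[x_1,x_2,\ldots]$ is the polynomial ring in countably many variables indexed by the positive integers, graded by $\deg x_i=i$ (weighted degree). Periodic sequences $s_j,\eta_j$ (subscripts read modulo $5$): $s_0=2,\ s_1=c,\ s_2=-1-c,\ s_3=-1-c,\ s_4=c$; and $\eta_0=0,\ \eta_1=1,\ \eta_2=c,\ \eta_3=-c,\ \eta_4=-1$ (only $s_j$ is needed for the definition of $g_n$). For $n\ge 2$, $$g_n=(s_n-c)x_n+\sum_{1\le i<n/2}s_{n-2i}\,x_ix_{n-i}+\begin{cases}x_{n/2}^2,&2\mid n,\\0,&2\nmid n.\end{cases}$$ Each $g_n$ is homogeneous of weighted degree $n$. $D=\{n\ge 2\mid n\equiv 0,2,3\pmod 5\}$ and $I=(g_n\mid n\in D)$ is the ideal of $S$ generated by these $g_n$; it is homogeneous, so $S/I$ is graded. $A=\{n\ge 1\mid n\equiv 1,4\pmod 5\}$ and $T=k[y_n\mid n\in A]$ with $\deg y_n=n$. The element $c$ is invertible since $c(c+1)=1$. Monomial order. Let $\mathcal M$ be the additive monoid of finitely supported exponent vectors $\alpha=(\alpha_i)_{i\ge1}$ of nonnegative integers, with $x^\alpha=\prod_{i\ge1}x_i^{\alpha_i}$. Put $\operatorname{wt}(\alpha)=\sum_i i\alpha_i$ and $\operatorname{sm}(\alpha)=\sum_i i^2\alpha_i$. For distinct $\alpha,\beta\in\mathcal M$ let $r=\min\{i\ge 1:\alpha_i\ne\beta_i\}$, and declare $x^\alpha\prec x^\beta$ if one of the following holds: (i) $\operatorname{wt}(\alpha)<\operatorname{wt}(\beta)$;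 (ii) $\operatorname{wt}(\alpha)=\operatorname{wt}(\beta)$ and $\operatorname{sm}(\alpha)>\operatorname{sm}(\beta)$; (iii) $\operatorname{wt}(\alpha)=\operatorname{wt}(\beta)$, $\operatorname{sm}(\alpha)=\operatorname{sm}(\beta)$ and $\alpha_r<\beta_r$. Let $\preceq$ be the reflexive closure of $\prec$. For $0\ne f\in S$, $\operatorname{lm}(f)$ is the $\preceq$-largest monomial in the support of $f$. For an ideal $\mathfrak a\subseteq S$, $\operatorname{in}(\mathfrak a)=\langle \operatorname{lm}(f):0\ne f\in\mathfrak a\rangle$. A set $\mathcal B\subseteq\mathfrak a\setminus\{0\}$ is a Gröbner basis of $\mathfrak a$ if $\operatorname{in}(\mathfrak a)=\langle\operatorname{lm}(g):g\in\mathcal B\rangle$. It is reduced if every $g\in\mathcal B$ is monic (leading coefficient $1$) and no monomial in the support of $g$ is divisible by $\operatorname{lm}(h)$ for any $h\in\mathcal B$, $h\ne g$. *)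

(* Defs.v *)
From HB Require Import structures.
From mathcomp Require Import all_boot all_order all_algebra.
From mathcomp Require Import finmap boolp classical_sets.
From mathcomp Require Import monalg.

Set Implicit Arguments.
Unset Strict Implicit.
Unset Printing Implicit Defensive.

Import GRing.Theory.
Local Open Scope ring_scope.
Local Open Scope quotient_scope.
Local Notation "1" := (@mone _) : monom_scope.
Local Notation "a * b" := (mmul a b) : monom_scope.

(** [{malg k[monom P]}] is the polynomial ring over [k] with one variable, of
    degree [n], for each [n \in P]. *)
Notation varidx P := {n : nat | n \in P}.
Notation monom P := (cmonom (varidx P)).

Definition posidx : {pred nat} := [pred n | 0 < n]%N.
Definition Aidx : {pred nat} := [pred n | (1 <= n) && (n %% 5 \in [:: 1; 4])]%N.
Definition Didx : {pred nat} :=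
  [pred n | (2 <= n) && (n %% 5 \in [:: 0; 2; 3])]%N.

Notation polyS k := {malg k[monom posidx]}.
Notation polyT k := {malg k[monom Aidx]}.

Section Grading.
Variable P : {pred nat}.

Definition wt (m : monom P) : nat := (\sum_(i <- finsupp m) val i * m i)%N.

Definition sm (m : monom P) : nat := (\sum_(i <- finsupp m) val i ^ 2 * m i)%N.

Definition homog (k : fieldType) (d : nat) : set {malg k[monom P]} :=
  [set f | forall m, m \in msupp f -> wt m = d].

(** The variable of index [n]; the value is [0] when [n] is not an index. *)
Definition pvar (k : fieldType) (n : nat) : {malg k[monom P]} :=
  if insub n is Some i then << ucm i >> else 0.
End Grading.

Notation x_ k n := (pvar posidx k n).
Notation y_ k n := (pvar Aidx k n).

Definition ideal_span (R : comNzRingType) (G : set R) : set R :=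
  [set f | exists (n : nat) (a g : 'I_n -> R),
     (forall i, G (g i)) /\ f = \sum_(i < n) a i * g i].

Section IdealSpanTheory.
Variables (R : comNzRingType) (G : set R).

Lemma ideal_span0 : ideal_span G 0.
Proof.
exists 0%N, (fun=> 0), (fun=> 0); split; first by case.
by rewrite big_ord0.
Qed.

Lemma ideal_spanMD (a u v : R) :
  ideal_span G u -> ideal_span G v -> ideal_span G (a * u + v).
Proof.
move=> [n [b [g [Gg ->]]]] [p [b' [g' [Gg' ->]]]].
exists (n + p)%N,
  (fun i => match split i with inl j => a * b j | inr j => b' j end),
  (fun i => match split i with inl j => g j | inr j => g' j end).
split; first by move=> i; case: (split i).
rewrite big_split_ord mulr_sumr; congr (_ + _); apply: eq_bigr => i _ /=.
  by rewrite -[lshift p i]/(unsplit (inl i)) unsplitK mulrA.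
by rewrite -[rshift n i]/(unsplit (inr i)) unsplitK.
Qed.

Lemma mem_ideal_span (g : R) : G g -> ideal_span G g.
Proof.
move=> Gg; exists 1%N, (fun=> 1), (fun=> g); split=> //.
by rewrite big_ord1 mul1r.
Qed.
End IdealSpanTheory.

Section QuotientAlgebra.
Variables (k : comNzRingType) (R : comAlgType k) (I : idealr R).
Local Notation Q := {ideal_quot I}.

Definition quot_scale (a : k) (u : Q) : Q := \pi_Q (a *: repr u).

Lemma pi_scale (a : k) (f : R) : quot_scale a (\pi_Q f) = \pi_Q (a *: f).
Proof.
apply/eqP; rewrite -Quotient.idealrBE -scalerBr -mulr_algl.
rewrite idealMr //.
by rewrite Quotient.idealrBE reprK.
Qed.

Lemma quot_scaleA a b u :
  quot_scale a (quot_scale b u) = quot_scale (a * b) u.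
Proof. by rewrite -[u]reprK !pi_scale scalerA !reprK. Qed.

Lemma quot_scale1 : left_id 1 quot_scale.
Proof. by move=> u; rewrite -[u]reprK pi_scale scale1r. Qed.

Lemma quot_scaleDr : right_distributive quot_scale +%R.
Proof.
move=> a u v; rewrite -[u]reprK -[v]reprK -[in LHS]rmorphD !pi_scale.
by rewrite scalerDr rmorphD.
Qed.

Lemma quot_scaleDl u : {morph quot_scale^~ u : a b / a + b}.
Proof. by move=> a b; rewrite -[u]reprK !pi_scale scalerDl rmorphD. Qed.

HB.instance Definition _ := GRing.Zmodule_isLmodule.Build k Q
  quot_scaleA quot_scale1 quot_scaleDr quot_scaleDl.

Lemma quot_scaleAl (a : k) (u v : Q) : a *: (u * v) = (a *: u) * v.
Proof.
have scE b (f : R) : b *: (\pi_Q f : Q) = \pi_Q (b *: f) by exact: pi_scale.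
rewrite -[u]reprK -[v]reprK -[in LHS]rmorphM.
by rewrite scE scalerAl rmorphM scE.
Qed.

HB.instance Definition _ := GRing.Lmodule_isLalgebra.Build k Q quot_scaleAl.
HB.instance Definition _ := GRing.Lalgebra_isComAlgebra.Build k Q.

Lemma pi_scalable : scalable (\pi_Q : R -> Q).
Proof. by move=> a f; apply: esym; apply: pi_scale. Qed.
End QuotientAlgebra.

Section Evaluation.
Variables (k : fieldType) (P : {pred nat}) (B : comAlgType k).
Variable v : varidx P -> B.

Definition mon_eval (m : monom P) : B := \prod_(i <- finsupp m) v i ^+ m i.

Lemma mon_evalEw (m : monom P) (d : {fset varidx P}) :
  fsubset (finsupp m) d -> mon_eval m = \prod_(i <- d) v i ^+ m i.
Proof.
move=> le; rewrite /mon_eval (big_fset_incl _ le) //.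
by move=> i _; rewrite -cmE_neq0 negbK => /eqP ->; rewrite expr0.
Qed.

Lemma mon_eval_mmorphism : mmorphism mon_eval.
Proof.
split=> [m1 m2|]; last by rewrite /mon_eval mdom1 big_seq_fset0.
rewrite {1}/mon_eval mdomD (mon_evalEw (fsubsetUl _ (finsupp m2))).
rewrite (mon_evalEw (fsubsetUr (finsupp m1) _)) -big_split /=.
by apply: eq_bigr => i _; rewrite cmM exprD.
Qed.

HB.instance Definition _ := isMultiplicative.Build (monom P) B mon_eval
  mon_eval_mmorphism.

Definition peval (f : {malg k[monom P]}) : B := mmap (in_alg B) mon_eval f.

Lemma peval_zmod : zmod_morphism peval.
Proof. exact: raddfB. Qed.

Lemma peval_monoid : monoid_morphism peval.
Proof. by split; [exact: rmorph1|exact: rmorphM]. Qed.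

HB.instance Definition _ := GRing.isZmodMorphism.Build
  {malg k[monom P]} B peval peval_zmod.
HB.instance Definition _ := GRing.isMonoidMorphism.Build
  {malg k[monom P]} B peval peval_monoid.

Lemma peval_scalable : scalable peval.
Proof. by move=> a f; rewrite /peval mmapZ mulr_algl. Qed.

HB.instance Definition _ := GRing.isScalable.Build k {malg k[monom P]} B *:%R
  peval peval_scalable.

Lemma peval_var (i : varidx P) : peval (pvar P k (val i)) = v i.
Proof.
rewrite /pvar valK /peval mmapU /= scale1r mul1r /mon_eval.
by rewrite mdomU big_seq_fset1 cmUU expr1.
Qed.
End Evaluation.

Definition graded_iso (k : comNzRingType) (U V : algType k)
    (Ud : nat -> set U) (Vd : nat -> set V) (f : {lrmorphism U -> V}) : Prop :=
  bijective f /\ forall d, (f @` Ud d = Vd d)%classic.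

Section Presentation.
Variables (k : fieldType) (c : k).

Definition s_ (j : nat) : k := nth 0 [:: 2; c; -1 - c; -1 - c; c] (j %% 5)%N.

Definition g_ (n : nat) : polyS k :=
  (s_ n - c) *: x_ k n
  + \sum_(1 <= i < n | (2 * i < n)%N)
      s_ (n - 2 * i)%N *: (x_ k i * x_ k (n - i)%N)
  + (if (2 %| n)%N then x_ k (n %/ 2)%N ^+ 2 else 0).

Definition ideal_I : set (polyS k) :=
  ideal_span [set g_ n | n in [set n | n \in Didx]]%classic.

(** [{ideal_quot _}] needs a boolean predicate, whence the classical [`[< _ >]]. *)
Definition ideal_Ib : {pred polyS k} := fun f => `[< ideal_I f >].

Lemma pvar_coeff1 n : (x_ k n)@_1%M = 0.
Proof.
rewrite /pvar; case: insub => [i|]; last by rewrite mcoeff0.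
by rewrite mcoeffU cm1_eq1.
Qed.

Lemma g_coeff1 n : (g_ n)@_1%M = 0.
Proof.
rewrite /g_ !mcoeffD mcoeffZ pvar_coeff1 mulr0 add0r raddf_sum /=.
rewrite big1 ?add0r => [|i _].
  by case: ifP => _; rewrite ?mcoeff0 // rmorphXn /= pvar_coeff1 expr0n.
by rewrite mcoeffZ rmorphM /= pvar_coeff1 mul0r mulr0.
Qed.

Lemma ideal_Ib_closed : idealr_closed ideal_Ib.
Proof.
split; rewrite ?unfold_in.
- exact/asboolP/ideal_span0.
- apply/asboolP => -[n [a [g [Gg]]]] /(congr1 (mcoeff 1%M)).
  rewrite mcoeff1 eqxx raddf_sum /= big1 => [/eqP|i _].
    by rewrite oner_eq0.
  by rewrite rmorphM /=; case: (Gg i) => j _ <-; rewrite g_coeff1 mulr0.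
- move=> a u v /asboolP Iu /asboolP Iv; exact/asboolP/ideal_spanMD.
Qed.

HB.instance Definition _ := isIdealr.Build (polyS k) ideal_Ib ideal_Ib_closed.

Definition quotSI := {ideal_quot ideal_Ib}.
HB.instance Definition _ := GRing.ComAlgebra.on quotSI.

Definition quot_cls (f : polyS k) : quotSI := \pi_{ideal_quot ideal_Ib} f.

Definition quot_homog (d : nat) : set quotSI :=
  [set quot_cls f | f in @homog posidx k d]%classic.

Definition theta : polyT k -> quotSI :=
  peval (fun n : varidx Aidx => quot_cls (x_ k (val n))).
HB.instance Definition _ := GRing.LRMorphism.on theta.
End Presentation.

Section MonomialOrder.
Local Open Scope nat_scope.
Implicit Types a b : monom posidx.

Definition first_diff a b (r : varidx posidx) : Prop :=
  a r <> b r /\ forall i, val i < val r -> a i = b i.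

Definition mon_lt a b : Prop :=
  exists r, first_diff a b r /\
    [\/ wt a < wt b,
        wt a = wt b /\ sm a > sm b
      | [/\ wt a = wt b, sm a = sm b & a r < b r]].

Definition mon_le a b : Prop := a = b \/ mon_lt a b.

Definition mon_dvd a b : Prop := exists d, b = (a * d)%M.

Lemma first_diff_ex a b : a <> b -> exists r, first_diff a b r.
Proof.
move=> ab.
have: exists n, [exists r : fset_sub_type (fsetU (finsupp a) (finsupp b)),
    (val (val r) == n) && (a (val r) != b (val r))].
  apply: contrapT => nex; apply: ab; apply/eqP/cmP => i.
  apply: contrapT => /eqP abi; apply: nex; exists (val i).
  have iU : i \in fsetU (finsupp a) (finsupp b).
    rewrite in_fsetU -!cmE_neq0.
    by case: (eqVneq (a i) 0) abi => //= ->; rewrite eq_sym.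
  by apply/existsP; exists (FSetSub iU); rewrite /= eqxx.
case/ex_minnP => n /existsP[[r rU] /= /andP[/eqP rn /eqP abr]] nmin.
exists r; split=> // i; rewrite ltnNge => /negP ltir.
apply: contrapT => /eqP abi; apply: ltir; apply: leq_trans (eq_leq rn) (nmin _ _).
have iU : i \in fsetU (finsupp a) (finsupp b).
  rewrite in_fsetU -!cmE_neq0.
  by case: (eqVneq (a i) 0) abi => //= ->; rewrite eq_sym.
by apply/existsP; exists (FSetSub iU); rewrite /= eqxx.
Qed.

Lemma first_diffC a b r : first_diff a b r -> first_diff b a r.
Proof. by case=> abr eqab; split=> [/esym //|i /eqab]. Qed.

Lemma mon_le_total a b : mon_le a b \/ mon_le b a.
Proof.
have [->|/eqP ab] := eqVneq a b; first by left; left.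
have [r fr] := first_diff_ex ab; have fr' := first_diffC fr.
case: (ltngtP (wt a) (wt b)) => [lt|lt|ew].
- by left; right; exists r; split=> //; constructor 1.
- by right; right; exists r; split=> //; constructor 1.
case: (ltngtP (sm a) (sm b)) => [lt|lt|es].
- by right; right; exists r; split=> //; constructor 2.
- by left; right; exists r; split=> //; constructor 2.
case: (ltngtP (a r) (b r)) => [lt|lt|e]; last by case: fr.
- by left; right; exists r; split=> //; constructor 3.
- by right; right; exists r; split=> //; constructor 3.
Qed.

Lemma first_diff_trans a b d r r' :
  first_diff a b r -> first_diff b d r' -> a r < b r -> b r' < d r' ->
  exists2 r'', first_diff a d r'' & a r'' < d r''.
Proof.
move=> [_ ab] [_ bd] ltab ltbd; case: (ltngtP (val r) (val r')) => [lt|lt|e].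
- exists r; last by rewrite -(bd _ lt).
  split; first by rewrite -(bd _ lt) => e; rewrite e ltnn in ltab.
  by move=> i ir; rewrite ab // bd // (ltn_trans ir).
- exists r'; last by rewrite (ab _ lt).
  split; first by rewrite (ab _ lt) => e; rewrite e ltnn in ltbd.
  by move=> i ir; rewrite ab ?bd // (ltn_trans ir).
- move/val_inj: e ltbd bd => <- ltbd bd; exists r.
    split; last by move=> i ir; rewrite ab // bd.
    by move=> e; have := ltn_trans ltab ltbd; rewrite e ltnn.
  exact: ltn_trans ltbd.
Qed.

Lemma mon_lt_neq a b : mon_lt a b -> a <> b.
Proof. by move=> [r [[abr _] _]] e; apply: abr; rewrite e. Qed.

Lemma mon_ltI a b : a <> b ->
  [\/ wt a < wt b, wt a = wt b /\ sm a > sm b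
    | [/\ wt a = wt b, sm a = sm b
        & exists2 r, first_diff a b r & a r < b r]] -> mon_lt a b.
Proof.
move=> /first_diff_ex[r fr] [h|h|[ew es [r' fr' ltr]]].
- by exists r; split=> //; constructor 1.
- by exists r; split=> //; constructor 2.
- by exists r'; split=> //; constructor 3.
Qed.

Lemma mon_lt_trans a b d : mon_lt a b -> mon_lt b d -> mon_lt a d.
Proof.
move=> [r [fr hr]] [r' [fr' hr']].
have key : [\/ wt a < wt d, wt a = wt d /\ sm a > sm d
    | [/\ wt a = wt d, sm a = sm d
        & exists2 r, first_diff a d r & a r < d r]].
  case: hr hr' => [w1|[w1 s1]|[w1 s1 l1]] [w2|[w2 s2]|[w2 s2 l2]].
  - by constructor 1; apply: ltn_trans w2.
  - by constructor 1; rewrite -w2.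
  - by constructor 1; rewrite -w2.
  - by constructor 1; rewrite w1.
  - by constructor 2; rewrite w1; split=> //; apply: ltn_trans s1.
  - by constructor 2; rewrite w1 -s2.
  - by constructor 1; rewrite w1.
  - by constructor 2; rewrite w1 s1.
  - constructor 3; rewrite w1 s1; split=> //.
    exact: first_diff_trans fr fr' l1 l2.
apply: mon_ltI => // ead; subst d.
case: key => [|[_]|[_ _ [q [nq _]]]]; by rewrite ?ltnn.
Qed.

Lemma mon_le_trans a b d : mon_le a b -> mon_le b d -> mon_le a d.
Proof.
move=> [->//|lab] [<-|lbd]; first by right.
by right; apply: mon_lt_trans lbd.
Qed.

Lemma mon_le_anti a b : mon_le a b -> mon_le b a -> a = b.
Proof.
move=> [//|lab] [//|lba].
by have /mon_lt_neq := mon_lt_trans lab lba.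
Qed.
End MonomialOrder.

Section Groebner.
Variable k : fieldType.
Implicit Types (f g h : polyS k) (a B : set (polyS k)).

Definition is_lm f (m : monom posidx) : Prop :=
  m \in msupp f /\ forall m', m' \in msupp f -> mon_le m' m.

(** The default value of [xget] is only reached for [f = 0]; see [lmP]. *)
Definition lm f : monom posidx := xget 1%M (is_lm f).

Lemma lmP f : f != 0 -> is_lm f (lm f).
Proof.
move=> f0; suff lmm : exists m, is_lm f m.
  by exact: (@xgetPex _ _ (is_lm f) lmm).
have : exists m, m \in (msupp f : seq _).
  case: (fset_0Vmem (msupp f)) => [/eqP|[m mf]]; last by exists m.
  by rewrite msupp_eq0 (negPf f0).
rewrite /is_lm => nex.
suff [m ms hm] : exists2 m, m \in (msupp f : seq _)
    & forall m', m' \in (msupp f : seq _) -> mon_le m' m by exists m.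
elim: (msupp f : seq _) nex => [[m]|m s IHs _]; first by rewrite in_nil.
case: (pselect (exists m', m' \in s)) => [/IHs[m' m's hm']|ns].
  case: (mon_le_total m m') => [mm'|m'm].
    exists m'; first by rewrite in_cons m's orbT.
    by move=> m''; rewrite in_cons => /orP[/eqP->|/hm'].
  exists m; first by rewrite in_cons eqxx.
  move=> m''; rewrite in_cons => /orP[/eqP->|/hm' le]; first by left.
  exact: mon_le_trans m'm.
exists m; first by rewrite in_cons eqxx.
move=> m''; rewrite in_cons => /orP[/eqP->|m''s]; first by left.
by case: ns; exists m''.
Qed.

Lemma lm_uniq f m : is_lm f m -> lm f = m.
Proof.
move=> lmm; have [lf hf] : is_lm f (lm f).
  by apply: (@xgetPex _ _ (is_lm f)); exists m.
by case: lmm => mf hm; apply: mon_le_anti; [exact: hm|exact: hf].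
Qed.

Definition in_ideal a : set (polyS k) :=
  ideal_span [set << lm f >> | f in [set f | a f /\ f != 0]]%classic.

Definition groebner_basis a B : Prop :=
  (forall g, B g -> a g /\ g != 0) /\
  in_ideal a = ideal_span [set << lm g >> | g in B]%classic.

Definition reduced_groebner_basis a B : Prop :=
  [/\ groebner_basis a B,
      forall g, B g -> g@_(lm g) = 1
    & forall g h, B g -> B h -> h <> g ->
        forall m, m \in msupp g -> ~ mon_dvd (lm h) m].
End Groebner.

Definition calG (k : fieldType) (c : k) : set (polyS k) :=
  ([set g_ c (2 * m)%N | m in [set m | (1 <= m)%N]]
   `|` [set c^-1 *: g_ c (2 * m + 1)%N | m in [set m | (1 <= m)%N]])%classic.

(* Main.v *)
Require Import Defs.
From HB Require Import structures.
From mathcomp Require Import all_boot all_order all_algebra.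
From mathcomp Require Import finmap boolp classical_sets.
From mathcomp Require Import monalg.
From mathcomp Require Import zify ring.

Set Implicit Arguments.
Unset Strict Implicit.
Unset Printing Implicit Defensive.

Import GRing.Theory.
Local Open Scope ring_scope.
Local Open Scope classical_set_scope.


(** Let [zeta] be a primitive fifth root of unity with [zeta + zeta^-1 = c], put
    [x_0 = 1] and [X(t) = sum_n x_n t^n], and write [X_j = X(zeta^j t)]. As
    [s_j = zeta^j + zeta^-j], the series [G(t) = sum_(n >= 2) g_n t^n] is
    [G_0 = X_1 X_(-1) - c X_0 - c^2]. In terms of [Y_j = X_j / c], the equations
    [G_j = 0] read [Y_(j-1) Y_(j+1) = Y_j + 1]: the pentagon recurrence,
    whose invertible solutions have period 5. Period 5 comes from the linear syzygy
    [X_2 G_(-1) - X_(-2) G_1 = c (G_2 - G_(-2))], and its coefficient of [t^N],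
    divided by [zeta - zeta^-1], is [g_syzygy]:
    [sum_i eta_(2i-j) x_i g_j = c eta_(2N) g_N] with [j = N - i]. Everything rests
    on this family of syzygies, one in each degree.

    The isomorphism. For [n] in [D] the coefficient [s_n - c] of [x_n] in [g_n] is
    invertible because 5 is, so [g_n = 0] expresses [x_n] through variables of
    smaller index. Solving recursively gives an algebra morphism [S_to_T] that
    kills the ideal and inverts [theta]; both respect the grading.

    The ideal contains every [g_n]. For [n] in [A] the terms with [g_n] in the
    syzygy of degree [n] add up to a nonzero multiple of [g_n], and the others are
    multiples of [g_j] with [j < n] ([ideal_g]).

    The Groebner basis. The monomial [ell n = x_(floor(n/2)) x_(ceil(n/2))] is the
    only one in [g_n] with the least sum of squares ([g_tail]). When [ell n] and
    [ell n'] share a variable, the S-polynomial of [g_n] and [g_n'] is made of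
    the two terms of least sum of squares in the syzygy of degree [N], where the
    least common multiple of [ell n] and [ell n'] splits [N] into three nearly
    equal parts ([lead_syzygy]); when they are coprime, the usual Koszul relation
    applies. So all S-polynomials reduce ([spair_lt], [spair]), and Buchberger's
    argument yields that leading monomials of the ideal are multiples of some
    [ell n] ([lm_ell]). In a fixed weight it is enough to filter by sums of
    squares, since the part of least sum of squares of each [g_n] is already a
    single monomial. Reducedness holds because [ell n'] has degree two and weight
    [n'] while [g_n] has degree at most two and weight [n]; uniqueness is the
    standard argument. *)

(** * Fifth roots of unity without adjoining them *)

Section PeriodFive.
Variables (k : fieldType) (c : k).
Hypothesis hc : c ^+ 2 + c = 1.

(** [eta j] is [(zeta^j - zeta^-j) / (zeta - zeta^-1)]; indices are natural numbers,
    so that [-u] is written [4 * u] below. *)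
Definition eta (j : nat) : k := nth 0 [:: 0; 1; c; - c; -1] (j %% 5)%N.

Lemma s_mod5 j : s_ c (j %% 5) = s_ c j.
Proof. by rewrite /s_ modn_mod. Qed.

Lemma eta_mod5 j : eta (j %% 5) = eta j.
Proof. by rewrite /eta modn_mod. Qed.

Lemma c_sq : c ^+ 2 = 1 - c.
Proof. by rewrite -hc addrK. Qed.

Lemma eq_s j j' : (j = j' %[mod 5])%N -> s_ c j = s_ c j'.
Proof. by rewrite -s_mod5 => ->; rewrite s_mod5. Qed.

Lemma eq_eta j j' : (j = j' %[mod 5])%N -> eta j = eta j'.
Proof. by rewrite -eta_mod5 => ->; rewrite eta_mod5. Qed.

Lemma s_opp j : s_ c (4 * j) = s_ c j.
Proof.
rewrite -s_mod5 -modnMmr s_mod5 -[RHS]s_mod5.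
by move: (j %% 5)%N (ltn_pmod j (isT : 0 < 5)%N) => [|[|[|[|[|]]]]].
Qed.

(** The product formula [(zeta - zeta^-1)^2 eta_u eta_v = s_(u+v) - s_(u-v)]. It turns
    coefficients of the syzygy into differences that cancel by reindexing. *)
Lemma etaM u v : (c ^+ 2 - 4) * (eta u * eta v) = s_ c (u + v) - s_ c (u + 4 * v).
Proof.
have -> : s_ c (u + v) = s_ c (u %% 5 + v %% 5) by apply: eq_s; rewrite modnDm.
have -> : s_ c (u + 4 * v) = s_ c (u %% 5 + 4 * (v %% 5)).
  by apply: eq_s; rewrite -modnDm -[in LHS]modnMmr modnDm modnDml.
rewrite -(eta_mod5 u) -(eta_mod5 v).
move: (u %% 5)%N (v %% 5)%N (ltn_pmod u (isT : 0 < 5)%N) (ltn_pmod v (isT : 0 < 5)%N).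
have h := c_sq.
by move=> [|[|[|[|[|]]]]] // [|[|[|[|[|]]]]] // _ _; rewrite /s_ /eta /=; ring: h.
Qed.

(** [c^2 - 4 = (zeta - zeta^-1)^2] divides 5, hence may be cancelled. *)
Lemma disc_unit : 5%N \notin [pchar k] -> c ^+ 2 - 4 != 0.
Proof.
move=> char_k; apply/eqP => h0; case/negP: char_k; rewrite inE /=; apply/eqP.
have h := c_sq.
have e : (5%:R : k) = (c - 2) * (c ^+ 2 - 4) by ring: h.
by rewrite e h0 mulr0.
Qed.

(** A non-symmetric half of [s_(p-q)]: [halfs p q + halfs q p = s_(p-q)] and
    [halfs p p = 1]. It writes [g_n + c x_n] as a full convolution in any characteristic,
    whereas halving [s] would exclude characteristic two. It is the value at
    [zeta^(p-q)] of the [k]-linear form sending 1 to 1 and [zeta] to 0. *)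
Definition halfs (p q : nat) : k := - eta (p + 4 * q + 4).
End PeriodFive.

(** * The pentagon syzygy *)

Section Syzygy.
Variables (k : fieldType) (c : k) (R : comAlgType k) (z : nat -> R).
Hypotheses (hc : c ^+ 2 + c = 1) (char_k : 5%N \notin [pchar k]).
Hypothesis z0 : z 0 = 1.
Local Notation eta := (eta c).
Local Notation halfs := (halfs c).

(** The coefficient of [t^N] in a product of three series. Three independent bounded
    indices, rather than nested dependent ones, make permuting them trivial. *)
Definition tripsum N (F : nat -> nat -> nat -> k) : R :=
  \sum_(i < N.+1) \sum_(p < N.+1) \sum_(q < N.+1)
     if (i + p + q == N)%N then F i p q *: (z i * z p * z q) else 0.

Lemma tripsum_rot N F : tripsum N (fun i p q => F q i p) = tripsum N F.
Proof.
rewrite /tripsum; under eq_bigr => i _ do rewrite exchange_big /=.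
rewrite exchange_big /=; apply: eq_bigr => q _; apply: eq_bigr => i _.
apply: eq_bigr => p _; rewrite addnC addnA; case: ifP => // _.
by congr (_ *: _); rewrite [LHS]mulrC mulrA.
Qed.

Lemma eq_tripsum N F F' :
  (forall i p q, (i + p + q = N)%N -> F i p q = F' i p q) ->
  tripsum N F = tripsum N F'.
Proof.
by move=> eF; do 3![apply: eq_bigr => ? _]; case: eqP => // /eF ->.
Qed.

Lemma tripsumB N F F' : tripsum N (fun i p q => F i p q - F' i p q) =
  tripsum N F - tripsum N F'.
Proof.
rewrite /tripsum -sumrB; apply: eq_bigr => i _; rewrite -sumrB.
apply: eq_bigr => p _; rewrite -sumrB; apply: eq_bigr => q _.
by case: ifP => _; rewrite ?subr0 // scalerBl.
Qed.

Lemma tripsumZ N a F : tripsum N (fun i p q => a * F i p q) = a *: tripsum N F.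
Proof.
rewrite /tripsum scaler_sumr; apply: eq_bigr => i _; rewrite scaler_sumr.
apply: eq_bigr => p _; rewrite scaler_sumr; apply: eq_bigr => q _.
by case: ifP => _; rewrite ?scaler0 // scalerA.
Qed.

(** The coefficient of [t^n] in [X_1 X_(-1)]. *)
Definition pairsum n : R := \sum_(p < n.+1) halfs p (n - p) *: (z p * z (n - p)%N).

Lemma tripsumE N (F : nat -> nat -> nat -> k) :
  tripsum N F =
  \sum_(i < N.+1) \sum_(p < (N - i).+1)
    F i p (N - i - p)%N *: (z i * z p * z (N - i - p)%N).
Proof.
apply: eq_bigr => i _.
rewrite [RHS](big_ord_widen_cond N.+1 xpredT
   (fun p => F i p (N - i - p)%N *: (z i * z p * z (N - i - p)%N))); last first.
  by rewrite ltnS leq_subr.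
rewrite [RHS]big_mkcond /=; apply: eq_bigr => p _; case: ifP => hp.
  have hq : (N - i - p < N.+1)%N by lia.
  have hi := ltn_ord i.
  rewrite (bigD1 (Ordinal hq)) //= big1 ?addr0; last first.
    move=> q /eqP nq; case: eqP => // e; case: nq; apply: val_inj => /=; lia.
  by case: eqP => // -[]; lia.
rewrite big1 // => q _; case: eqP => // e; lia.
Qed.

(** The cubic terms of [X_2 G_(-1) - X_(-2) G_1] are
    [X_2 (X_(-2) X_0) - X_(-2) (X_0 X_2) = 0]. On coefficients, [etaM] writes the
    summand as [F i p - F q i], and both parts have the same sum by cyclic symmetry. *)
Lemma cubic_part N :
  \sum_(i < N.+1) eta (2 * i + 4 * (N - i)) *: (z i * pairsum (N - i)%N) = 0.
Proof.
transitivity (tripsum N (fun i p q => eta (2 * i + 4 * (p + q)) * halfs p q)).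
  rewrite tripsumE; apply: eq_bigr => i _.
  rewrite /pairsum mulr_sumr scaler_sumr; apply: eq_bigr => p _.
  rewrite -scalerAr scalerA mulrA; congr (eta _ * _ *: _).
  by have := ltn_ord p; lia.
apply: (scalerI (disc_unit hc char_k)); rewrite scaler0 -tripsumZ.
(* The symmetric index [2 (i - p) + 1] of [s], modulo 5. *)
pose F i p (q : nat) := s_ c (2 * i + 3 * p + 1)%N.
rewrite (eq_tripsum (F' := fun i p q => F i p q - F q i p)); last first.
  move=> i p q _; rewrite /F /halfs 2!mulrN etaM // opprB; congr (_ - _).
    by apply: eq_s; lia.
  rewrite -[RHS]s_opp; apply: eq_s; lia.
by rewrite tripsumB (tripsum_rot N F) subrr.
Qed.

(** On both sides, once multiplied by [c^2 - 4], the coefficients of [z_i z_(N-i)]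
    differ by an expression [F i - F (N - i)], whose sum vanishes by symmetry. *)
Lemma quadratic_part N :
  \sum_(i < N.+1) eta (2 * i + 4 * (N - i)) *: (z i * z (N - i)%N)
  = - (eta (2 * N) *: pairsum N).
Proof.
apply/eqP; rewrite -addr_eq0 /pairsum scaler_sumr -big_split /=.
apply/eqP/(scalerI (disc_unit hc char_k)); rewrite scaler0 scaler_sumr.
pose F i := s_ c (2 * (N - i) + 4 * (i + 1))%N.
transitivity (\sum_(i < N.+1) (F i *: (z i * z (N - i)%N)
                          - F (N - i)%N *: (z i * z (N - i)%N))).
  apply: eq_bigr => i _; have hi : (i <= N)%N by rewrite -ltnS.
  rewrite scalerA -scalerDl -scalerBl scalerA; congr (_ *: _).
  rewrite /halfs mulrDr 2!mulrN etaM //.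
  have -> : eta (2 * i + 4 * (N - i)) = eta (2 * i + 4 * (N - i)) * eta 1.
    by rewrite /eta /= mulr1.
  rewrite etaM // /F.
  have -> : s_ c (2 * i + 4 * (N - i) + 1) = s_ c (2 * N + (i + 4 * (N - i) + 4)).
    rewrite -s_opp; apply: eq_s; lia.
  have -> : s_ c (2 * (N - i) + 4 * (i + 1))
      = s_ c (2 * N + 4 * (i + 4 * (N - i) + 4)).
    rewrite -s_opp; apply: eq_s; lia.
  have -> : s_ c (2 * (N - (N - i)) + 4 * (N - i + 1))
      = s_ c (2 * i + 4 * (N - i) + 4 * 1).
    apply: eq_s; lia.
  ring.
rewrite sumrB; apply/eqP; rewrite subr_eq0; apply/eqP.
rewrite [RHS](reindex_inj rev_ord_inj) /=; apply: eq_bigr => i _.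
have hi : (i <= N)%N by rewrite -ltnS.
have -> : (N.+1 - i.+1 = N - i)%N by [].
by rewrite (subKn hi) [z i * _]mulrC.
Qed.

(** The term of index [i = N], where [G] has no constant term, is responsible for the
    correction [1 - c = c^2]. *)
Lemma linear_syzygy N : (0 < N)%N ->
  \sum_(i < N) eta (2 * i + 4 * (N - i)) *:
      (z i * (pairsum (N - i)%N - c *: z (N - i)%N))
  = (c * eta (2 * N)) *: (pairsum N - c *: z N).
Proof.
move=> N0.
pose E i := eta (2 * i + 4 * (N - i)) *:
  (z i * (pairsum (N - i)%N - c *: z (N - i)%N)).
have : \sum_(i < N.+1) E i = (c * eta (2 * N)) *: pairsum N.
  rewrite -[RHS]add0r -[X in X + _](cubic_part N) -scalerA.
  rewrite -[eta (2 * N) *: pairsum N]opprK.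
  rewrite -quadratic_part scalerN scaler_sumr -sumrB; apply: eq_bigr => i _.
  rewrite /E mulrBr scalerBr; congr (_ - _).
  by rewrite -scalerAr !scalerA mulrC.
rewrite big_ord_recr /= => /(canRL (addrK _)); rewrite -/(E N) => ->.
rewrite /E subnn muln0 addn0 z0 /pairsum big_ord1 /= subn0 z0 mul1r.
have -> : halfs 0 0 = 1 by rewrite /halfs /eta /= opprK.
rewrite -scalerBl -scalerAr mulr1 scalerA scalerBr scalerA.
congr (_ - _ *: _); have := c_sq hc; move: (eta _) => e h.
by ring: h.
Qed.
End Syzygy.

(** * The polynomials g_n as convolutions *)

Section Folding.
Variables (k : fieldType) (c : k).

Lemma halfs_sym u v : halfs c u v + halfs c v u = s_ c (u + 4 * v).
Proof.
rewrite /halfs.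
have -> : eta c (u + 4 * v + 4) = eta c ((u + 4 * v) %% 5 + 4).
  by apply: eq_eta; rewrite modnDml.
have -> : eta c (v + 4 * u + 4) = eta c (4 * ((u + 4 * v) %% 5) + 4).
  by apply: eq_eta; lia.
rewrite -[in RHS]s_mod5.
move: ((u + 4 * v) %% 5)%N (ltn_pmod (u + 4 * v) (isT : 0 < 5)%N).
by move=> [|[|[|[|[|]]]]] // _; rewrite /s_ /eta /=; ring.
Qed.

Lemma halfs_diag p : halfs c p p = 1.
Proof.
by rewrite /halfs (eq_eta c (_ : _ = 4 %[mod 5])%N) /eta /= ?opprK //; lia.
Qed.

(** Pairing each index with its mirror image; the middle index stands alone. *)
Lemma sum_fold (V : nmodType) n (F : nat -> V) :
  \sum_(p < n.+1) F p =
  \sum_(0 <= p < n | (2 * p < n)%N) (F p + F (n - p)%N)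
  + (if (2 %| n)%N then F (n %/ 2)%N else 0).
Proof.
rewrite (bigID (fun p : 'I__ => (2 * p < n)%N)) /=.
rewrite [X in _ + X = _](bigID (fun p : 'I__ => (2 * p == n)%N)) /=.
rewrite addrA addrAC [in RHS]big_split /=; congr (_ + _ + _).
- rewrite [RHS]big_mkord [LHS](big_ord_widen_cond n.+1 (fun p => (2 * p < n)%N) F) //.
  rewrite [RHS](big_ord_widen_cond n.+1 (fun p => (2 * p < n)%N) F) //.
  apply: eq_bigl => i /=; lia.
- rewrite [RHS]big_mkord [RHS](big_ord_widen_cond n.+1 (fun p => (2 * p < n)%N)
    (fun p => F (n - p)%N)) // [LHS](reindex_inj rev_ord_inj) /=.
  by apply: eq_big => [i|i _]; [have hi := ltn_ord i; lia | rewrite subSS].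
case: ifP => [/dvdnP[m e]|/negP nd].
  rewrite e mulnK //; have hm : (m < (m * 2).+1)%N by lia.
  rewrite (bigD1 (Ordinal hm)) //=; last by lia.
  rewrite big1 ?addr0 // => i /andP[/andP[_ /eqP hi]] /eqP ni; case: ni.
  by apply: val_inj => /=; lia.
rewrite big1 // => i /andP[_ /eqP hi]; case: nd.
by rewrite -hi dvdn_mulr.
Qed.

(** Folding the convolution recovers the shape in which [g_n] is defined. *)
Lemma pairsumE (R : comAlgType k) (z : nat -> R) n : z 0 = 1 -> (0 < n)%N ->
  pairsum c z n = s_ c n *: z n
  + \sum_(1 <= i < n | (2 * i < n)%N) s_ c (n - 2 * i) *: (z i * z (n - i)%N)
  + (if (2 %| n)%N then z (n %/ 2)%N ^+ 2 else 0).
Proof.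
move=> z0 n0; rewrite /pairsum.
rewrite (sum_fold n (fun p => halfs c p (n - p) *: (z p * z (n - p)%N))).
congr (_ + _); last first.
  case: ifP => // /dvdnP[m e]; rewrite e mulnK //.
  by rewrite (_ : (m * 2 - m)%N = m) ?halfs_diag ?scale1r // -?expr2; lia.
have E i : (i <= n)%N -> halfs c i (n - i) *: (z i * z (n - i)%N)
    + halfs c (n - i) (n - (n - i)) *: (z (n - i)%N * z (n - (n - i))%N)
    = s_ c (n + 3 * i) *: (z i * z (n - i)%N).
  move=> le; rewrite subKn // [z (n - i)%N * _]mulrC -scalerDl addrC halfs_sym.
  by congr (_ *: _); apply: eq_s; lia.
rewrite big_ltn_cond // muln0 n0 E // z0 mul1r subn0 addn0; congr (_ + _).
apply: congr_big_nat => // i /andP[lt _]; rewrite E; last by lia.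
by congr (_ *: _); apply: eq_s; lia.
Qed.
End Folding.

(** * Weights, sums of squares and the leading terms of g_n *)

Section Weights.
Variable P : {pred nat}.
Implicit Types a b m : monom P.

Lemma wsumM (F : nat -> nat) a b :
  (\sum_(i <- finsupp (mmul a b)) F (val i) * mmul a b i
   = \sum_(i <- finsupp a) F (val i) * a i + \sum_(i <- finsupp b) F (val i) * b i)%N.
Proof.
have Ew m d : fsubset (finsupp m) d ->
    (\sum_(i <- finsupp m) F (val i) * m i = \sum_(i <- d) F (val i) * m i)%N.
  move=> le; rewrite (big_fset_incl _ le) // => i _.
  by rewrite -cmE_neq0 negbK => /eqP ->; rewrite muln0.
rewrite mdomD (Ew a _ (fsubsetUl _ (finsupp b))) (Ew b _ (fsubsetUr (finsupp a) _)).
by rewrite -big_split /=; apply: eq_bigr => i _; rewrite cmM mulnDr.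
Qed.

Lemma wtM a b : wt (mmul a b) = (wt a + wt b)%N.
Proof. exact: (wsumM id). Qed.

Lemma smM a b : sm (mmul a b) = (sm a + sm b)%N.
Proof. exact: (wsumM (fun n => n ^ 2)%N). Qed.

Lemma wt1 : wt (mone : monom P) = 0%N.
Proof. by rewrite /wt mdom1 big_seq_fset0. Qed.

Lemma sm1 : sm (mone : monom P) = 0%N.
Proof. by rewrite /sm mdom1 big_seq_fset0. Qed.

Lemma wtU (i : varidx P) : wt (ucm i) = val i.
Proof. by rewrite /wt mdomU big_seq_fset1 cmUU muln1. Qed.

Lemma smU (i : varidx P) : sm (ucm i) = (val i ^ 2)%N.
Proof. by rewrite /sm mdomU big_seq_fset1 cmUU muln1. Qed.

Variable k : fieldType.
Implicit Types f g : {malg k[monom P]}.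

(** The polynomials of weight [w] all of whose monomials have sum of squares at least
    [s]. Within a weight a larger sum of squares means a smaller monomial. *)
Definition filt (w s : nat) : set {malg k[monom P]} :=
  [set f | forall m, m \in msupp f -> wt m = w /\ (s <= sm m)%N].

Lemma filt_homog w : filt w 0 = @homog P k w.
Proof.
by apply/seteqP; split=> f h m /h; [case | split].
Qed.

Lemma filt0 w s : filt w s 0.
Proof. by move=> m; rewrite msupp0. Qed.

Lemma filtD w s f g : filt w s f -> filt w s g -> filt w s (f + g).
Proof.
by move=> hf hg m /(fsubsetP (msuppD_le _ _)); rewrite in_fsetU => /orP[/hf|/hg].
Qed.

Lemma filtZ w s (t : k) f : filt w s f -> filt w s (t *: f).
Proof. by move=> hf m /(fsubsetP (msuppZ_le _ _)) /hf. Qed.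

Lemma filt_sum w s (I : Type) (r : seq I) (Q : pred I) F :
  (forall i, Q i -> filt w s (F i)) -> filt w s (\sum_(i <- r | Q i) F i).
Proof.
move=> h; elim/big_rec: _ => [|i f Qi hf]; first exact: filt0.
by apply: filtD => //; exact: h.
Qed.

Lemma filtM w s w' s' f g : filt w s f -> filt w' s' g ->
  filt (w + w') (s + s') (f * g).
Proof.
move=> hf hg m /msuppM_le[m1 [m2 [/hf[<- h1] /hg[<- h2] ->]]].
by rewrite wtM smM; split=> //; exact: leq_add.
Qed.

Lemma filtW w s s' f : (s' <= s)%N -> filt w s f -> filt w s' f.
Proof. by move=> le hf m /hf[-> h]; split=> //; exact: leq_trans h. Qed.

Lemma filtU (t : k) m : filt (wt m) (sm m) << t *g m >>.
Proof. by move=> m' /(fsubsetP msuppU_le); rewrite in_fset1 => /eqP ->. Qed.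

Lemma filt_coeff0 w s f m : filt w s f -> (sm m < s)%N -> f@_m = 0.
Proof.
by move=> hf lt; apply: mcoeff_outdom; apply/negP => /hf[_]; rewrite leqNgt lt.
Qed.
End Weights.

Section IndexMonomials.
(** With the value [1] at [0] this extends the variables by [x_0 = 1]. *)
Definition xmon (n : nat) : monom posidx := if insub n is Some i then ucm i else mone.

Lemma xmon0 : xmon 0 = mone.
Proof. by rewrite /xmon insubF. Qed.

Lemma xmonE n (h : n \in posidx) : xmon n = ucm (Sub n h).
Proof. by rewrite /xmon (insubT (fun n => n \in posidx)). Qed.

Lemma wt_xmon n : wt (xmon n) = n.
Proof.
by rewrite /xmon; case: insubP => [i _ <-|]; [rewrite wtU | rewrite wt1; case: n].
Qed.

Lemma sm_xmon n : sm (xmon n) = (n ^ 2)%N.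
Proof.
by rewrite /xmon; case: insubP => [i _ <-|]; [rewrite smU | rewrite sm1; case: n].
Qed.

Lemma pvar_xmon (k : fieldType) n : (0 < n)%N -> x_ k n = << xmon n >>.
Proof.
move=> h; rewrite /pvar (insubT (fun n => n \in posidx) (h : n \in posidx)).
by rewrite (xmonE h).
Qed.

Lemma malgU_xmon0 (k : fieldType) : << xmon 0 >> = 1 :> polyS k.
Proof. by rewrite xmon0. Qed.

Lemma malgUM (k : fieldType) a b : << a >> * << b >> = << mmul a b >> :> polyS k.
Proof. by rewrite malgM_def fgmulUU mulr1. Qed.

Definition ell n : monom posidx := mmul (xmon n./2) (xmon (uphalf n)).
Definition minsq n := (n./2 ^ 2 + (uphalf n) ^ 2)%N.

Lemma wt_ell n : wt (ell n) = n.
Proof. by rewrite wtM !wt_xmon addnC uphalf_half -addnA addnn odd_double_half. Qed.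

Lemma sm_ell n : sm (ell n) = minsq n.
Proof. by rewrite smM !sm_xmon. Qed.

Variables (k : fieldType) (c : k).

Definition lcoef n : k := if odd n then c else 1.

(** The index [0] of the convolution contributes the linear term [s_n x_n], thanks to
    [x_0 = 1]. *)
Lemma g_pairsum n : (0 < n)%N ->
  g_ c n = pairsum c (fun n => << xmon n >>) n - c *: << xmon n >>.
Proof.
move=> n0; rewrite pairsumE ?malgU_xmon0 // /g_ scalerBl pvar_xmon //.
have addE (V : zmodType) (a b u v u' v' : V) :
    u = u' -> v = v' -> a - b + u + v = a + u' + v' - b.
  by move=> -> ->; rewrite [RHS]addrAC [a + u' - b]addrAC.
apply: addE.
  apply: congr_big_nat; [by []|by []|by []|] => i /andP[_ /andP[i0 lt]].
  rewrite pvar_xmon; last by [].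
  by rewrite pvar_xmon; last by rewrite subn_gt0.
case: (boolP (2 %| n)%N) => [/dvdnP[m e]|_]; last by [].
have n2 : (0 < n %/ 2)%N by rewrite e mulnK; lia.
by rewrite pvar_xmon; last by exact: n2.
Qed.

(** Among the splittings of [n] into at most two parts, the balanced one has strictly
    the least sum of squares. *)
Lemma g_tail n : (2 <= n)%N ->
  filt n (minsq n).+1 (g_ c n - lcoef n *: << ell n >>).
Proof.
move=> n2; rewrite /g_.
have hx : filt n (minsq n).+1 ((s_ c n - c) *: x_ k n).
  apply: filtZ; rewrite pvar_xmon; last by lia.
  rewrite -{1}(wt_xmon n); apply: filtW (@filtU _ _ _ _).
  rewrite sm_xmon /minsq -{2 3}(odd_double_half n) uphalf_half.
  move: n2; rewrite -{1}(odd_double_half n).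
  by case: (odd n); move: (n./2) => m /=; nia.
have hxx i : (0 < i)%N -> (2 * i < n)%N -> i != n./2 ->
    filt n (minsq n).+1 (s_ c (n - 2 * i) *: (x_ k i * x_ k (n - i))).
  move=> i0 lt ne; apply: filtZ; rewrite !pvar_xmon //; last by lia.
  rewrite malgUM; have e : wt (mmul (xmon i) (xmon (n - i))) = n.
    by rewrite wtM !wt_xmon; lia.
  rewrite -{1}e; apply: filtW (@filtU _ _ _ _).
  rewrite smM !sm_xmon /minsq.
  have [d ed] : exists d, (n./2 = i + d.+1)%N by exists (n./2 - i.+1)%N; lia.
  rewrite uphalf_half ed.
  have -> : (n - i = odd n + i + d.+1 + d.+1)%N.
    by rewrite -{1}(odd_double_half n) ed; lia.
  by case: (odd n) => /=; nia.
have cancelE (V : zmodType) (a b r : V) : a + (b + r) - b = a + r.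
  by rewrite addrCA addrAC subrr add0r.
have split_n : (n = odd n + n./2 + n./2)%N by rewrite -{1}(odd_double_half n); lia.
rewrite /lcoef /ell uphalf_half big_nat_cond big_mkcond.
case: (boolP (odd n)) split_n => on split_n.
  rewrite (_ : (2 %| n)%N = false) ?addr0; last by rewrite dvdn2 on.
  rewrite (bigD1_seq n./2) ?iota_uniq //=; last by rewrite mem_index_iota; lia.
  have cnd : (0 < n./2 < n)%N && (2 * n./2 < n)%N = true by lia.
  rewrite cnd.
  rewrite (_ : (n - 2 * n./2 = 1)%N); last by lia.
  rewrite (@pvar_xmon k n./2); last by lia.
  rewrite (@pvar_xmon k (n - n./2)); last by lia.
  rewrite malgUM (_ : (n - n./2 = true + n./2)%N) ?cancelE; last by lia.
  apply: filtD => //; apply: filt_sum => i ne; case: ifP => [|_]; last exact: filt0.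
  by move=> /andP[/andP[i0 _] lt]; apply: hxx.
rewrite (_ : (2 %| n)%N = true) ?dvdn2 // divn2 scale1r.
rewrite (@pvar_xmon k n./2) ?expr2; last by lia.
rewrite malgUM -addrA subrr addr0; apply: filtD => //.
apply: filt_sum => i ne; case: ifP => [|_]; last exact: filt0.
by move=> /andP[/andP[i0 _] lt]; apply: hxx => //; lia.
Qed.

Lemma g_filt n : (2 <= n)%N -> filt n (minsq n) (g_ c n).
Proof.
move=> n2; rewrite -[g_ c n](subrK (lcoef n *: << ell n >>)); apply: filtD.
  exact: filtW (g_tail n2).
by apply: filtZ; rewrite -{1}(wt_ell n) -sm_ell; exact: filtU.
Qed.

Lemma g_coeff_ell n : (2 <= n)%N -> (g_ c n)@_(ell n) = lcoef n.
Proof.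
move=> n2; rewrite -[g_ c n](subrK (lcoef n *: << ell n >>)) mcoeffD.
rewrite (filt_coeff0 (g_tail n2)) ?sm_ell // add0r mcoeffZ mcoeffUU.
by rewrite mulr1.
Qed.
End IndexMonomials.

(** * Combinations of the g_n and the lead terms of the syzygy *)

Section Span.
Variables (k : fieldType) (c : k).
Hypotheses (hc : c ^+ 2 + c = 1) (char_k : 5%N \notin [pchar k]).
Local Notation eta := (eta c).
Local Notation g := (g_ c).
Local Notation lcoef := (lcoef c).
Implicit Types (f : polyS k) (m d : monom posidx).

Lemma malgZE (P : {pred nat}) (f : {malg k[monom P]}) :
  f = \sum_(m <- msupp f) f@_m *: << m >>.
Proof.
rewrite [LHS](monalgE f); apply: eq_bigr => m _.
by rewrite -[RHS]mul_malgC malgM_def fgmulUU mul1m mulr1.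
Qed.

(** The span of the multiples of the [g_n] which, in weight [w], involve only monomials
    of sum of squares at least [s]. Multiples in other weights are unconstrained, so
    that the whole ideal lies in [rspan w 0]. *)
Inductive rspan (w s : nat) : polyS k -> Prop :=
| rspan0 : rspan w s 0
| rspan_cons a m n f : (2 <= n)%N -> ((wt m + n)%N = w -> (s <= sm m + minsq n)%N) ->
    rspan w s f -> rspan w s (a *: (<< m >> * g n) + f).

Lemma rspanD w s f f' : rspan w s f -> rspan w s f' -> rspan w s (f + f').
Proof.
move=> hf hf'; elim: hf => [|a m n f0 n2 h _ IH]; rewrite ?add0r // -addrA.
by constructor.
Qed.

Lemma rspanZ w s a f : rspan w s f -> rspan w s (a *: f).
Proof.
elim=> [|b m n f0 n2 h _ IH]; first by rewrite scaler0; constructor.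
by rewrite scalerDr scalerA; constructor.
Qed.

Lemma rspanB w s f f' : rspan w s f -> rspan w s f' -> rspan w s (f - f').
Proof. by move=> hf hf'; rewrite -scaleN1r; apply: rspanD => //; apply: rspanZ. Qed.

Lemma rspan_sum w s (I : Type) (r : seq I) (Q : pred I) F :
  (forall i, Q i -> rspan w s (F i)) -> rspan w s (\sum_(i <- r | Q i) F i).
Proof.
move=> h; elim/big_rec: _ => [|i f Qi hf]; first by constructor.
by apply: rspanD => //; exact: h.
Qed.

Lemma rspan_gen w s m n : (2 <= n)%N -> ((wt m + n)%N = w -> (s <= sm m + minsq n)%N) ->
  rspan w s (<< m >> * g n).
Proof.
move=> n2 h; rewrite -[_ * _]scale1r -[_ *: _]addr0.
by constructor => //; constructor.
Qed.

Lemma rspan_mulU w s d f : rspan w s f -> rspan (wt d + w) (sm d + s) (<< d >> * f).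
Proof.
elim=> [|b m n f0 n2 h _ IH]; first by rewrite mulr0; constructor.
rewrite mulrDr -scalerAr mulrA malgUM; constructor => //.
by rewrite wtM smM -!addnA => /addnI /h; rewrite leq_add2l.
Qed.

Lemma rspan_filt w s n f : (2 <= n)%N -> filt w s f ->
  rspan (w + n) (s + minsq n) (f * g n).
Proof.
move=> n2 hf; rewrite (malgZE f) mulr_suml big_seq_cond.
apply: rspan_sum => m; rewrite andbT => /hf[e le]; rewrite -scalerAl.
by apply: rspanZ; apply: rspan_gen => // _; rewrite leq_add2r.
Qed.

Lemma rspan_supp w s f m : rspan w s f -> m \in msupp f -> wt m = w -> (s <= sm m)%N.
Proof.
move=> hf; elim: hf m => [m|a m n f0 n2 h _ IH m']; first by rewrite msupp0.
move=> /(fsubsetP (msuppD_le _ _)); rewrite in_fsetU => /orP[|/IH //].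
move=> /(fsubsetP (msuppZ_le _ _)).
have /[apply] := filtM (@filtU _ k 1 m) (@g_filt k c n n2).
by case=> -> le e; apply: leq_trans le; apply: h.
Qed.

Lemma g_1 : g 1 = 0.
Proof.
by rewrite /g_ big_geq // addr0 /s_ /= subrr scale0r addr0.
Qed.

(** The pentagon syzygy, for the sequence [x_n] with [x_0 = 1]. *)
Lemma g_syzygy N : (0 < N)%N ->
  \sum_(i < N) eta (2 * i + 4 * (N - i)) *: (<< xmon i >> * g (N - i)%N)
  = (c * eta (2 * N)) *: g N.
Proof.
move=> N0; rewrite (g_pairsum c N0).
have := @linear_syzygy k c _ (fun n => << xmon n >> : polyS k) hc char_k
  (malgU_xmon0 k) N N0.
apply: etrans; apply: eq_bigr => i _.
have Ni : (0 < N - i)%N by rewrite subn_gt0; exact: ltn_ord.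
by rewrite (g_pairsum c Ni).
Qed.

Lemma minsq_ge n : (n ^ 2 <= 2 * minsq n)%N.
Proof. by rewrite /minsq uphalf_half -{1}(odd_double_half n); case: (odd n); nia. Qed.

(** In the syzygy of degree [N = a + t + b], with [a, t, b] nearly equal, every term
    other than [x_b g_(a+t)] and [x_a g_(t+b)] has a larger sum of squares: the leading
    monomial of [x_i g_(N-i)] splits [N] into three parts, and the only better balanced
    splitting [(a+1, a+1, a+1)], when [b = a + 2], has coefficient [eta 0 = 0]. The
    coefficients of the two remaining terms are those of an S-polynomial. *)
Lemma lead_syzygy a t b : (0 < a)%N -> (a <= t <= b)%N -> (t <= a.+1)%N ->
  (b <= t.+1)%N -> (a < b)%N ->
  rspan (a + t + b) (a ^ 2 + t ^ 2 + b ^ 2).+1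
    (lcoef (t + b) *: (<< xmon b >> * g (a + t))
     - lcoef (a + t) *: (<< xmon a >> * g (t + b))).
Proof.
move=> a0 /andP[at_ tb] ta bt ab; set N := (a + t + b)%N; set s0 := (a ^ 2 + _ + _)%N.
have shape : [\/ (t = a /\ b = a + 1)%N, (t = a + 1 /\ b = a + 1)%N
  | (t = a + 1 /\ b = a + 2)%N].
  have [e|e] : (t = a \/ t = a + 1)%N by lia.
    by constructor 1; lia.
  have [e'|e'] : (b = t \/ b = t + 1)%N by lia.
    by constructor 2; lia.
  by constructor 3; lia.
pose F i := eta (2 * i + 4 * (N - i)) *: (<< xmon i >> * g (N - i)%N).
have key : rspan N s0.+1 (F b + F a).
  have hb : (b < N)%N by lia.
  have ha : (a < N)%N by lia.
  have N0 : (0 < N)%N by lia.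
  have := g_syzygy N0; rewrite (bigD1 (Ordinal hb)) //=.
  rewrite (bigD1 (Ordinal ha)) /=; last first.
    by apply/eqP => -[]; lia.
  rewrite addrA -/(F a) -/(F b) => /(canRL (addrK _)) ->.
  have N2 : (2 <= N)%N by lia.
  have qN : (s0 < minsq N)%N.
    have := minsq_ge N; suff : (2 * s0 < N ^ 2)%N by lia.
    by case: shape => -[et eb]; rewrite /s0 /N et eb; nia.
  apply: rspanB.
    apply: rspanZ; rewrite -[g N]mul1r -(malgU_xmon0 k); apply: rspan_gen => // _.
    by rewrite xmon0 sm1.
  apply: rspan_sum => i /andP[/eqP nb /eqP na].
  have hi := ltn_ord i; rewrite -/(F i).
  have nb' : nat_of_ord i <> b by move=> e; apply: nb; apply: val_inj.
  have na' : nat_of_ord i <> a by move=> e; apply: na; apply: val_inj.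
  move: (nat_of_ord i) hi na' nb' => {na nb}i hi na nb.
  case: (posnP i) => [->|i0].
    rewrite /F subn0; apply: rspanZ; apply: rspan_gen => // _.
    by rewrite xmon0 sm1.
  have [Ni|Ni] := leqP 2 (N - i); last first.
    rewrite /F (_ : N - i = 1)%N; last by lia.
    by rewrite g_1 mulr0 scaler0; constructor.
  have [e0|e0] := eqVneq (eta (2 * i + 4 * (N - i))) 0.
    by rewrite /F e0 scale0r; constructor.
  apply: rspanZ; apply: rspan_gen => // _; rewrite sm_xmon.
  (* The splitting [(a+1, a+1, a+1)] is excluded by [eta 0 = 0]. *)
  have nt : ~ (i = a + 1 /\ b = a + 2)%N.
    case=> ei eb; case/eqP: e0; rewrite -[RHS]/(eta 0); apply: eq_eta.
    by rewrite /N; lia.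
  (* After [minsq_ge], the bound is a quadratic inequality in [i - a], whose only
     integer exceptions are the indices excluded above. *)
  have := minsq_ge (N - i); suff : (2 * s0 < 2 * i ^ 2 + (N - i) ^ 2)%N by lia.
  have [[u ei]|[u ei]] : (exists u, i = a + u.+1)%N \/ (exists u, a = i + u.+1)%N.
  - have [lt|lt] : (a < i)%N \/ (i < a)%N by lia.
      by left; exists (i - a.+1)%N; lia.
    by right; exists (a - i.+1)%N; lia.
  - have [j ej] : exists j, j = (N - i)%N by exists (N - i)%N.
    have [v ev] : exists v, v = u.+1 by exists u.+1.
    have ejv : (j + v = t + b)%N by lia.
    have h1 : ((j + v) * (j + v) = (t + b) * (t + b))%N by rewrite ejv.
    have h2 : ((j + v) * v = (t + b) * v)%N by rewrite ejv.
    rewrite -ej ei -ev /s0 !expnS !expn0 !muln1; clear - nb na nt ei ev h1 h2 shape.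
    case: shape => -[et eb]; move: h1 h2 nb nt; rewrite et eb ei -ev => h1 h2 nb nt.
    + have h3 : (2 * v <= v * v)%N by rewrite leq_mul2r; lia.
      lia.
    + have h3 : (2 * v <= v * v)%N by rewrite leq_mul2r; lia.
      lia.
    + have h3 : (3 * v <= v * v)%N by rewrite leq_mul2r; lia.
      lia.
  - have [j ej] : exists j, j = (N - i)%N by exists (N - i)%N.
    have ejt : (j + i = a + t + b)%N by lia.
    rewrite -ej /s0; clear - ejt ei shape.
    case: shape => -[et eb].
    + by rewrite et eb ei (_ : j = 2 * i + 3 * u.+1 + 1)%N; [nia | lia].
    + by rewrite et eb ei (_ : j = 2 * i + 3 * u.+1 + 2)%N; [nia | lia].
    + by rewrite et eb ei (_ : j = 2 * i + 3 * u.+1 + 3)%N; [nia | lia].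
have eb : (N - b = a + t)%N by lia.
have ea : (N - a = t + b)%N by lia.
rewrite /F eb ea in key.
have etaE u v : (u = v %[mod 5])%N -> eta u = eta v by exact: eq_eta.
suff gen (Y Z : polyS k) :
    rspan N s0.+1 (eta (2 * b + 4 * (a + t)) *: Y + eta (2 * a + 4 * (t + b)) *: Z) ->
    rspan N s0.+1 (lcoef (t + b) *: Y - lcoef (a + t) *: Z) by exact: gen key.
clear - shape etaE.
rewrite /lcoef; case: shape => -[et ebb]; rewrite et ebb.
- have -> : odd (a + (a + 1)) = true by lia.
  have -> : odd (a + a) = false by lia.
  rewrite (etaE _ 2%N) ?(etaE (2 * a + _)%N 4%N) ?/eta /=; [|lia|lia].
  by rewrite scaleN1r scale1r.
- have -> : odd (a + 1 + (a + 1)) = false by lia.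
  have -> : odd (a + (a + 1)) = true by lia.
  rewrite (etaE _ 1%N) ?(etaE (2 * a + _)%N 3%N) ?/eta /=; [|lia|lia].
  by rewrite scaleNr.
- have -> : odd (a + 1 + (a + 2)) = true by lia.
  have -> : odd (a + (a + 1)) = true by lia.
  rewrite (etaE _ 3%N) ?(etaE (2 * a + _)%N 2%N) ?/eta /=; [|lia|lia].
  move=> /(rspanZ (-1)); rewrite scaleN1r opprD scaleNr opprK.
  exact.
Qed.
End Span.

(** * S-polynomials *)

Section LeadingMonomials.
Variables (k : fieldType) (c : k).
Hypotheses (hc : c ^+ 2 + c = 1) (char_k : 5%N \notin [pchar k]).
Local Notation eta := (eta c).
Local Notation g := (g_ c).
Local Notation lcoef := (lcoef c).
Local Notation rspan := (rspan c).
Implicit Types (f : polyS k) (m d : monom posidx).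

Lemma mmulI m u v : mmul m u = mmul m v -> u = v.
Proof.
move=> e; apply/eqP/cmP => i; apply: (@addnI (m i)).
by rewrite -!cmM e.
Qed.

(** Distinct variables are coprime. *)
Lemma xmon_cancel i j u v : (0 < i)%N -> (0 < j)%N -> i <> j ->
  mmul (xmon i) u = mmul (xmon j) v ->
  exists d, u = mmul (xmon j) d /\ v = mmul (xmon i) d.
Proof.
move=> i0 j0 ij e.
have ev : forall r, ((xmon i) r + u r = (xmon j) r + v r)%N.
  by move=> r; rewrite -!cmM e.
have exmon n (n0 : (0 < n)%N) r : (xmon n) r = (n == val r) :> nat.
  by rewrite (xmonE (n0 : n \in posidx)) cmU -val_eqE.
exists (divcm u (xmon j)); split; apply/eqP/cmP => r; rewrite cmM divcmE exmon //;
  have := ev r; rewrite ?exmon //; case: eqP => [<-|_]; case: eqP => //; lia.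
Qed.

(** Buchberger's product criterion: with [T = G - a L] and [T' = G' - b L'], the
    S-polynomial of [G] and [G'] is [T G' - T' G]. *)
Lemma coprime_spair (A : comAlgType k) (a b : k) (D L L' G G' : A) :
  b *: (D * L' * G) - a *: (D * L * G')
  = D * ((G - a *: L) * G' - (G' - b *: L') * G).
Proof.
rewrite -!mulrA [b *: _]scalerAr [a *: (D * _)]scalerAr -mulrBr; congr (D * _).
rewrite scalerAl [a *: (L * _)]scalerAl; move: (a *: L) (b *: L') => {a b D L L'} x y.
ring.
Qed.

Lemma mul_spair (A : comAlgType k) (a b : k) (D P Q G G' : A) :
  D * (b *: (P * G) - a *: (Q * G')) = b *: (D * P * G) - a *: (D * Q * G').
Proof. by rewrite mulrBr -!scalerAr !mulrA. Qed.

(** For [n < n'] the only variable that [ell n] and [ell n'] can share is [x_t] with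
    [t = uphalf n = n'./2]; then their least common multiple is a product of three
    variables with nearly equal indices and [lead_syzygy] applies. Otherwise they
    are coprime. *)
Lemma spair_lt n n' m m' : (2 <= n)%N -> (n < n')%N ->
  mmul m (ell n) = mmul m' (ell n') ->
  rspan (wt m + n) (sm m + minsq n).+1
    (lcoef n' *: (<< m >> * g n) - lcoef n *: (<< m' >> * g n')).
Proof.
move=> n2 lt; have n2' : (2 <= n')%N by lia.
rewrite /ell; set a := n./2; set b := uphalf n; set a' := n'./2; set b' := uphalf n'.
have en : n = (a + b)%N by rewrite /a /b; lia.
have en' : n' = (a' + b')%N by rewrite /a' /b'; lia.
have a0 : (0 < a)%N by rewrite /a; lia.
have h1 : (a <= b <= a.+1)%N by rewrite /a /b; lia.
have h2 : (a' <= b' <= a'.+1)%N by rewrite /a' /b'; lia.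
have h3 : (b <= a')%N by lia.
have e1 u : mmul m (mmul u (xmon b)) = mmul (xmon b) (mmul u m).
  by rewrite mulmA mulmC (mulmC m).
have e2 u : mmul m' (mmul (xmon a') u) = mmul (xmon a') (mmul u m').
  by rewrite (mulmC m') mulmA.
move=> e.
have [eab|nab] := eqVneq b a'.
  have e' : mmul (xmon a) m = mmul (xmon b') m'.
    by apply: (@mmulI (xmon b)); rewrite -e1 e eab e2.
  have b'0 : (0 < b')%N by rewrite /b'; lia.
  have ab' : a <> b' by lia.
  have [d [-> ->]] := xmon_cancel a0 b'0 ab' e'.
  have ab_le : (a <= b <= b')%N by lia.
  have ba : (b <= a.+1)%N by lia.
  have b'b : (b' <= b.+1)%N by lia.
  have ltab' : (a < b')%N by lia.
  have := rspan_mulU d (lead_syzygy hc char_k a0 ab_le ba b'b ltab').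
  rewrite (mulmC (xmon b') d) (mulmC (xmon a) d).
  rewrite -(malgUM k d (xmon b')) -(malgUM k d (xmon a)).
  rewrite mul_spair en en' -eab.
  have -> : (wt d + (a + b + b') = wt (mmul d (xmon b')) + (a + b))%N.
    by rewrite wtM wt_xmon; lia.
  suff -> : (sm d + (a ^ 2 + b ^ 2 + b' ^ 2).+1
      = (sm (mmul d (xmon b')) + minsq (a + b)).+1)%N by [].
  by rewrite smM sm_xmon -en /minsq -/a -/b; lia.
have b'0 : (0 < b')%N by rewrite /b'; lia.
have a'0 : (0 < a')%N by lia.
have b0 : (0 < b)%N by lia.
have ca : a <> a' by move/eqP: nab; lia.
have ca' : a <> b' by move/eqP: nab; lia.
have cb : b <> a' by apply/eqP.
have cb' : b <> b' by move/eqP: nab; lia.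
have [d [em em']] : exists d, m = mmul d (mmul (xmon a') (xmon b'))
    /\ m' = mmul d (mmul (xmon a) (xmon b)).
  have : mmul (xmon a) (mmul (xmon b) m) = mmul (xmon a') (mmul (xmon b') m').
    by rewrite !mulmA mulmC e mulmC.
  case/(xmon_cancel a0 a'0 ca) => u [/(xmon_cancel b0 a'0 cb)[v [-> eu]] ev].
  move: ev; rewrite eu mulmA (mulmC (xmon a)) -mulmA.
  move/esym; case/(xmon_cancel b0 b'0 cb') => w [e1' ->].
  have [d [-> ->]] := xmon_cancel a0 b'0 ca' e1'.
  exists d; split; first by rewrite [RHS]mulmC mulmA.
  by rewrite [RHS]mulmC mulmA (mulmC (xmon b)).
rewrite em em' -/(ell n) -/(ell n') -(malgUM k d (ell n)) -(malgUM k d (ell n')).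
have r1 := rspan_filt c n2' (@g_tail k c n n2).
have r2 := rspan_filt c n2 (@g_tail k c n' n2').
rewrite (addnC n' n) addSn (addnC (minsq n')) -addSn in r2.
have := rspan_mulU d (rspanB r1 r2).
rewrite coprime_spair wtM smM wt_ell sm_ell.
have -> : (wt d + (n + n') = wt d + n' + n)%N by lia.
suff -> : (sm d + ((minsq n).+1 + minsq n') = (sm d + minsq n' + minsq n).+1)%N by [].
by lia.
Qed.

Lemma lcoef_neq0 n : lcoef n != 0.
Proof.
rewrite /lcoef; case: ifP => _; last exact: oner_neq0.
apply/eqP => c0; have := hc; rewrite c0 expr0n addr0 => /esym/eqP.
by rewrite oner_eq0.
Qed.

Lemma spair n n' m m' : (2 <= n)%N -> (2 <= n')%N ->
  mmul m (ell n) = mmul m' (ell n') ->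
  rspan (wt m + n) (sm m + minsq n).+1
    ((lcoef n)^-1 *: (<< m >> * g n) - (lcoef n')^-1 *: (<< m' >> * g n')).
Proof.
move=> n2 n2' e.
have swap (V : lmodType k) (x y : V) (a b : k) : a != 0 -> b != 0 ->
    a^-1 *: x - b^-1 *: y = (a^-1 * b^-1) *: (b *: x - a *: y).
  move=> a0 b0; rewrite scalerBr !scalerA mulfVK //.
  by rewrite mulrAC mulVf // mul1r.
rewrite swap ?lcoef_neq0 //; apply: rspanZ.
case: (ltngtP n n') => [lt|lt|en]; first exact: spair_lt.
  have -> : (wt m + n = wt m' + n')%N.
    by rewrite -{1}(wt_ell n) -wtM e wtM wt_ell.
  have -> : (sm m + minsq n = sm m' + minsq n')%N.
    by rewrite -(sm_ell n) -smM e smM sm_ell.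
  rewrite -opprB -scaleN1r; apply: rspanZ.
  by apply: spair_lt.
have em : m = m' by apply: (@mmulI (ell n)); rewrite mulmC e mulmC en.
by rewrite em en subrr; constructor.
Qed.
End LeadingMonomials.

(** * Leading monomials of the ideal *)

Section Reduction.
Variables (k : fieldType) (c : k).
Hypotheses (hc : c ^+ 2 + c = 1) (char_k : 5%N \notin [pchar k]).
Local Notation eta := (eta c).
Local Notation g := (g_ c).
Local Notation lcoef := (lcoef c).
Local Notation rspan := (rspan c).
Implicit Types (f : polyS k) (m d M : monom posidx).

Definition ell_mult M : Prop := exists p : monom posidx * nat,
  (2 <= p.2)%N /\ M = mmul p.1 (ell p.2).

(** For each monomial divisible by some [ell n], one chosen monic multiple of a [g_n]
    with that leading monomial; by [spair] the choice is immaterial modulo smaller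
    monomials. *)
Definition reductor M : polyS k :=
  match pselect (ell_mult M) with
  | left e => let p := sval (cid e) in (lcoef p.2)^-1 *: (<< p.1 >> * g p.2)
  | right _ => 0
  end.

Lemma reductor_spair n m : (2 <= n)%N ->
  rspan (wt m + n) (sm m + minsq n).+1
    ((lcoef n)^-1 *: (<< m >> * g n) - reductor (mmul m (ell n))).
Proof.
move=> n2; rewrite /reductor; case: pselect => [e|[]]; last by exists (m, n).
case: (cid e) => -[m' n'] [/= n2' e']; exact: spair.
Qed.

Lemma mul_g_coeff n m M : (2 <= n)%N -> (sm M <= sm m + minsq n)%N ->
  (<< m >> * g n)@_M = (M == mmul m (ell n))%:R * lcoef n.
Proof.
move=> n2 le.
have [t ht ->] : exists2 t, filt n (minsq n).+1 t & g n = t + lcoef n *: << ell n >>.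
  by exists (g n - lcoef n *: << ell n >>); [exact: g_tail | rewrite subrK].
have h := filtM (@filtU _ k 1 m) ht.
have h0 : (<< m >> * t)@_M = 0 by apply: (filt_coeff0 h); rewrite addnS.
have h1 : (<< m >> * (lcoef n *: << ell n >>))@_M = (M == mmul m (ell n))%:R * lcoef n.
  by rewrite -scalerAr malgUM mcoeffZ mcoeffU eq_sym mulrC.
by rewrite mulrDr mcoeffD; apply: etrans (congr2 +%R h0 h1) (add0r _).
Qed.

Lemma reductor_coeff M M' : sm M' = sm M -> M' <> M -> (reductor M)@_M' = 0.
Proof.
move=> es ne; rewrite /reductor; case: pselect => [e|ne']; last by rewrite mcoeff0.
case: (cid e) => -[m n] [/= n2 eM].
have sM' : sm M' = (sm m + minsq n)%N by rewrite es eM smM sm_ell.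
rewrite mcoeffZ mul_g_coeff ?sM' // -eM; case: eqP => // _.
by rewrite mul0r mulr0.
Qed.

(** The combination of reductors that matches the coefficients of [f] at the monomials
    of weight [w] and sum of squares [s]. The finite set [E] is kept fixed, instead of
    the support of [f], so that this is linear in [f]. *)
Definition top_red (w s : nat) (E : {fset monom posidx}) f : polyS k :=
  \sum_(M <- E | (wt M == w) && (sm M == s)) f@_M *: reductor M.

Lemma top_redD w s E f f' : top_red w s E (f + f') = top_red w s E f + top_red w s E f'.
Proof.
rewrite /top_red -big_split; apply: eq_bigr => M _.
by rewrite mcoeffD scalerDl.
Qed.

Lemma top_redZ w s E a f : top_red w s E (a *: f) = a *: top_red w s E f.
Proof.
rewrite /top_red scaler_sumr; apply: eq_bigr => M _.
by rewrite mcoeffZ scalerA.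
Qed.

Lemma top_red_single w s (E : {fset monom posidx}) f M0 (a : k) :
  M0 \in E -> wt M0 = w -> sm M0 = s ->
  (forall M, sm M = s -> f@_M = (M == M0)%:R * a) ->
  top_red w s E f = a *: reductor M0.
Proof.
move=> hE ew es cf; rewrite /top_red -big_filter (bigD1_seq M0) /=; first last.
- by rewrite filter_uniq ?fset_uniq.
- by rewrite mem_filter hE ew es !eqxx.
rewrite (cf M0 es) eqxx mul1r -[RHS]addr0; congr (_ + _).
rewrite big_filter_cond big1 // => M /andP[/andP[_ /eqP sM] ne].
by rewrite cf // (negPf ne) mul0r scale0r.
Qed.

(** One step of reduction for a single multiple of [g_n]: if it lies on the boundary
    [sm = s] of the filtration, it has one monomial there, and subtracting the matching
    reductor leaves an S-polynomial. *)
Lemma top_red_gen w s m n (E : {fset monom posidx}) : (2 <= n)%N ->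
  ((wt m + n)%N = w -> (s <= sm m + minsq n)%N) -> mmul m (ell n) \in E ->
  rspan w s.+1 (<< m >> * g n - top_red w s E (<< m >> * g n)).
Proof.
move=> n2 h hE; set M0 := mmul m (ell n) in hE *.
have [/eqP ew|nw] := boolP (wt m + n == w)%N; last first.
  rewrite /top_red big1 ?subr0.
    by apply: rspan_gen => // e; rewrite e eqxx in nw.
  move=> M /andP[/eqP wM _]; rewrite (mcoeff_outdom (k := M)) ?scale0r //.
  apply/negP => /(filtM (@filtU _ k 1 m) (@g_filt k c n n2))[e _].
  by rewrite -e wM eqxx in nw.
have := h ew; rewrite leq_eqVlt => /orP[/eqP es|lt]; last first.
  rewrite /top_red big1 ?subr0; first by apply: rspan_gen.
  move=> M /andP[_ /eqP sM].
  rewrite (filt_coeff0 (filtM (@filtU _ k 1 m) (@g_filt k c n n2))) ?scale0r //.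
  by rewrite sM.
have cf M : sm M = s -> (<< m >> * g n)@_M = (M == M0)%:R * lcoef n.
  by move=> sM; rewrite mul_g_coeff // sM es.
have wM0 : wt M0 = w by rewrite wtM wt_ell.
have sM0 : sm M0 = s by rewrite smM sm_ell.
rewrite (top_red_single hE wM0 sM0 cf).
rewrite -[X in X - _](scalerKV (lcoef_neq0 hc n)) -scalerBr.
apply: rspanZ; rewrite -ew es; exact: reductor_spair.
Qed.

Lemma top_red_raises w s f : rspan w s f -> exists E0 : {fset monom posidx},
  forall E, fsubset E0 E -> rspan w s.+1 (f - top_red w s E f).
Proof.
elim=> [|a m n f0 n2 h _ [E0 IH]].
  exists fset0 => E _; rewrite /top_red big1 ?subrr; first by constructor.
  by move=> M _; rewrite mcoeff0 scale0r.
exists (fsetU [fset mmul m (ell n)] E0)%fset => E.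
rewrite fsubUset => /andP[/fsubsetP hM /IH hf0].
rewrite top_redD top_redZ opprD addrACA -scalerBr; apply: rspanD => //.
apply: rspanZ; apply: top_red_gen => //.
by apply: hM; rewrite in_fset1.
Qed.

(** An element of the span without monomials on the boundary of the filtration can be
    rewritten without using multiples that reach it: this is where the cancellation of
    leading terms is resolved. *)
Lemma rspan_step w s f : rspan w s f ->
  (forall M, M \in msupp f -> wt M = w -> sm M <> s) -> rspan w s.+1 f.
Proof.
move=> /top_red_raises[E /(_ E (fsubset_refl E))] h ns.
rewrite -[f]subr0; suff <- : top_red w s E f = 0 by [].
apply: big1 => M /andP[/eqP wM /eqP sM]; rewrite mcoeff_outdom ?scale0r //.
by apply/negP => /ns /(_ wM).
Qed.

Lemma rspan_lead w s f M : rspan w s f -> M \in msupp f -> wt M = w -> sm M = s ->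
  ell_mult M.
Proof.
move=> /top_red_raises[E /(_ E (fsubset_refl E))] h Mf wM sM; apply: contrapT => nM.
have : M \in msupp (f - top_red w s E f).
  rewrite -mcoeff_neq0 mcoeffB raddf_sum big1 ?subr0 ?mcoeff_neq0 //.
  move=> M' /andP[_ /eqP sM'].
  rewrite /= mcoeffZ; have [e|/eqP ne] := eqVneq M M'.
    by rewrite -e /reductor; case: pselect => // _; rewrite mcoeff0 mulr0.
  by rewrite reductor_coeff ?mulr0 // sM.
by move=> /(rspan_supp h) /(_ wM); rewrite sM ltnn.
Qed.

(** Raise [s] with [rspan_step] until it meets the least sum of squares in the support,
    then read off the boundary with [rspan_lead]. *)
Lemma rspan_lm w f M : rspan w 0 f -> M \in msupp f -> wt M = w ->
  (forall M', M' \in msupp f -> wt M' = w -> (sm M <= sm M')%N) -> ell_mult M.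
Proof.
move=> h Mf wM hmin; suff hs s : (s <= sm M)%N -> rspan w s f.
  exact: rspan_lead (hs _ (leqnn _)) Mf wM erefl.
elim: s => // s IH lt; apply: rspan_step; first exact: IH (ltnW lt).
by move=> M' /hmin h' /h' le e; rewrite -e ltnNge le in lt.
Qed.

Local Notation I := (ideal_I c).

Lemma idealM a f : I f -> I (a * f).
Proof.
by move=> h; rewrite -[a * f]addr0; apply: ideal_spanMD => //; exact: ideal_span0.
Qed.

Lemma idealD f f' : I f -> I f' -> I (f + f').
Proof. by move=> h h'; rewrite -[f]mul1r; apply: ideal_spanMD. Qed.

Lemma idealZ a f : I f -> I (a *: f).
Proof. by move=> h; rewrite -mulr_algl; apply: idealM. Qed.

Lemma idealB f f' : I f -> I f' -> I (f - f').
Proof. by move=> h h'; rewrite -scaleN1r; apply: idealD => //; apply: idealZ. Qed.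

Lemma ideal_sum (J : Type) (r : seq J) (Q : pred J) F :
  (forall i, Q i -> I (F i)) -> I (\sum_(i <- r | Q i) F i).
Proof.
move=> h; elim/big_rec: _ => [|i f Qi hf]; first exact: ideal_span0.
by apply: idealD => //; exact: h.
Qed.

(** If [n] is 1 or 4 modulo 5, the syzygy of degree [n] has the terms
    [c eta_(2n) g_n] and [eta_(-n) g_n], and [c eta_(2n) - eta_(-n)] divides 5; all its
    other terms involve [g_j] with [j < n]. *)
Lemma ideal_g n : (2 <= n)%N -> I (g n).
Proof.
elim/ltn_ind: n => n IH n2.
have [nD|nD] := boolP (n \in Didx); first by apply: mem_ideal_span; exists n.
have n0 : (0 < n)%N by lia.
have unit : c * eta (2 * n) - eta (4 * n) != 0.
  have h := c_sq hc; apply/eqP => e0; case/negP: char_k; rewrite inE /=; apply/eqP.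
  have [r1|r4] : (n %% 5 = 1 \/ n %% 5 = 4)%N.
  - by move: nD; rewrite !inE; lia.
  - have e : (5%:R : k) = (3 + c) * (c * c - -1) by ring: h.
    rewrite e; move: e0; rewrite (@eq_eta _ c _ 2) ?(@eq_eta _ c (4 * n) 4); try lia.
    by rewrite /eta /= => ->; rewrite mulr0.
  have e : (5%:R : k) = - (3 + c) * (c * - c - 1) by ring: h.
  rewrite e; move: e0; rewrite (@eq_eta _ c _ 3) ?(@eq_eta _ c (4 * n) 1); try lia.
  by rewrite /eta /= => ->; rewrite mulr0.
have := g_syzygy hc char_k n0; rewrite (bigD1 (Ordinal n0)) //= subn0 muln0 add0n.
have subE (V : lmodType k) (x y r : V) (a b : k) :
    a *: x + r = b *: y -> x = y -> r = (b - a) *: y.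
  by move=> e xy; rewrite scalerBl -e xy addrC addKr.
have xmon0_g : << xmon 0 >> * g n = g n by rewrite malgU_xmon0 mul1r.
move=> /subE /(_ xmon0_g) e.
rewrite -(scalerK unit (g n)); apply: idealZ; rewrite -e; apply: ideal_sum => i ni.
apply: idealZ; apply: idealM; have hi := ltn_ord i.
have i0 : (0 < i)%N by rewrite lt0n; apply: contra_neq ni => e0; apply: val_inj.
have [ni2|ni1] := leqP 2 (n - i); first by apply: IH => //; lia.
by rewrite (_ : n - i = 1)%N ?g_1; [exact: ideal_span0 | lia].
Qed.

Lemma ideal_rspan w f : I f -> rspan w 0 f.
Proof.
case=> n [a [h [hG ->]]]; apply: rspan_sum => i _.
case: (hG i) => d /andP[d2 _] <-; rewrite (malgZE (a i)) mulr_suml.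
apply: rspan_sum => m _; rewrite -scalerAl; apply: rspanZ.
exact: rspan_gen.
Qed.

(** A leading monomial has the largest weight in the support and, in that weight, the
    least sum of squares, so [rspan_lm] applies to it. *)
Lemma lm_ell f : I f -> f != 0 -> ell_mult (lm f).
Proof.
move=> hf /lmP[lf hl]; apply: (rspan_lm (ideal_rspan (wt (lm f)) hf) lf) => // M Mf wM.
case: (hl _ Mf) => [->//|[r [_ [|[_ /ltnW]|[_ -> _]]]]] //.
by rewrite wM ltnn.
Qed.
End Reduction.

(** * The reduced Groebner basis *)

Section GroebnerBasis.
Variables (k : fieldType) (c : k).
Hypotheses (hc : c ^+ 2 + c = 1) (char_k : 5%N \notin [pchar k]).
Local Notation g := (g_ c).
Local Notation lcoef := (lcoef c).
Local Notation I := (ideal_I c).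
Implicit Types (f : polyS k) (m d M : monom posidx).

(** The elements of the Groebner basis for both parities of [n]. *)
Definition gmonic n : polyS k := (lcoef n)^-1 *: g n.

Lemma calGP f : calG c f <-> exists2 n, (2 <= n)%N & f = gmonic n.
Proof.
split.
  case=> -[m /= m1 <-].
    exists (2 * m)%N; first by lia.
    by rewrite /gmonic /lcoef (_ : odd (2 * m) = false) ?invr1 ?scale1r //; lia.
  exists (2 * m + 1)%N; first by lia.
  by rewrite /gmonic /lcoef (_ : odd (2 * m + 1) = true) //; lia.
case=> n n2 ->; rewrite /gmonic /lcoef; case: (boolP (odd n)) => on.
  right; exists n./2; first by rewrite /=; lia.
  by congr (_ *: g _); lia.
left; exists n./2; first by rewrite /=; lia.
by rewrite invr1 scale1r; congr g; lia.
Qed.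

Lemma gmonic_coeff n : (2 <= n)%N -> (gmonic n)@_(ell n) = 1.
Proof. by move=> n2; rewrite mcoeffZ g_coeff_ell // mulVf ?lcoef_neq0. Qed.

Lemma gmonic_neq0 n : (2 <= n)%N -> gmonic n != 0.
Proof.
move=> /gmonic_coeff h; apply/eqP => e; move: h; rewrite e mcoeff0 => /eqP.
by rewrite eq_sym oner_eq0.
Qed.

Lemma gmonic_supp n m : (2 <= n)%N -> m \in msupp (gmonic n) ->
  m = ell n \/ wt m = n /\ (minsq n < sm m)%N.
Proof.
move=> n2 /(fsubsetP (msuppZ_le _ _)).
have [t ht ->] : exists2 t, filt n (minsq n).+1 t & g n = t + lcoef n *: << ell n >>.
  by exists (g n - lcoef n *: << ell n >>); [exact: g_tail | rewrite subrK].
move=> /(fsubsetP (msuppD_le _ _)); rewrite in_fsetU => /orP[/ht|]; first by right.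
move=> /(fsubsetP (msuppZ_le _ _)) /(fsubsetP msuppU_le); rewrite in_fset1 => /eqP.
by left.
Qed.

Lemma lm_gmonic n : (2 <= n)%N -> lm (gmonic n) = ell n.
Proof.
move=> n2; apply: lm_uniq; split.
  by rewrite -mcoeff_neq0 gmonic_coeff ?oner_neq0.
move=> m /(gmonic_supp n2)[->|[wm sm_]]; first by left.
right; apply: mon_ltI.
  by move=> e; move: sm_; rewrite e sm_ell ltnn.
by constructor 2; rewrite wm wt_ell sm_ell.
Qed.

Lemma ideal_gmonic n : (2 <= n)%N -> I (gmonic n).
Proof. by move=> n2; apply: idealZ; apply: ideal_g. Qed.

Lemma mdeg_xmon n : mdeg (xmon n) = (0 < n)%N.
Proof.
case: n => [|n]; first by rewrite xmon0 mdeg1.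
by rewrite (xmonE (isT : n.+1 \in posidx)) mdegU.
Qed.

Lemma mdeg_ell n : (2 <= n)%N -> mdeg (ell n) = 2%N.
Proof. by move=> n2; rewrite /ell mdegM !mdeg_xmon; lia. Qed.

Lemma mdeg_le_wt m : (mdeg m <= wt m)%N.
Proof.
rewrite mdegE; apply: leq_sum => i _; apply: leq_pmull; exact: (valP i).
Qed.

Lemma wt_eq0 m : wt m = 0%N -> m = mone.
Proof. by move=> w0; apply: mdeg_eq0I; have := mdeg_le_wt m; rewrite w0; lia. Qed.

Lemma g_mdeg n m : (2 <= n)%N -> m \in msupp (g n) -> (mdeg m <= 2)%N.
Proof.
move=> n2; rewrite g_pairsum; last by lia.
pose low f := forall m, m \in msupp f -> (mdeg m <= 2)%N.
have lowD f f' : low f -> low f' -> low (f + f').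
  by move=> h h' p /(fsubsetP (msuppD_le _ _)); rewrite in_fsetU => /orP[/h|/h'].
have lowZ a f : low f -> low (a *: f).
  by move=> h p /(fsubsetP (msuppZ_le _ _)) /h.
have lowU p : (mdeg p <= 2)%N -> low << p >>.
  by move=> h p' /(fsubsetP msuppU_le); rewrite in_fset1 => /eqP ->.
apply: (_ : low _); rewrite -scaleNr; apply: (lowD); last first.
  by apply: (lowZ); apply: lowU; rewrite mdeg_xmon; case: (0 < n)%N.
rewrite /pairsum; elim/big_rec: _ => [p|p f _ hf]; first by rewrite msupp0.
apply: (lowD) => //; apply: (lowZ); rewrite malgUM; apply: lowU.
rewrite mdegM !mdeg_xmon.
by case: (0 < p)%N; case: (0 < n - p)%N.
Qed.

(** [ell n'] has degree two, which is the largest degree in [g_n], so a multiple of it in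
    the support is [ell n'] itself; weights then identify [n'] with [n]. *)
Lemma gmonic_dvd n n' m : (2 <= n)%N -> (2 <= n')%N -> m \in msupp (gmonic n) ->
  mon_dvd (ell n') m -> n' = n /\ m = ell n.
Proof.
move=> n2 n2' hm [d em].
have /(g_mdeg n2) : m \in msupp (g n) by move/(fsubsetP (msuppZ_le _ _)): hm.
rewrite em mdegM mdeg_ell // => hd.
have d1 : d = mone by apply: mdeg_eq0I; lia.
rewrite em d1 mulm1 in hm *; suff -> : n' = n by [].
case: (gmonic_supp n2 hm) => [e|[e _]]; first by rewrite -(wt_ell n') e wt_ell.
by rewrite -(wt_ell n') e.
Qed.

Lemma ideal_spanS (R : comNzRingType) (G G' : set R) :
  (forall u, G u -> ideal_span G' u) -> ideal_span G `<=` ideal_span G'.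
Proof.
move=> h u [n [a [b [hb ->]]]]; elim/big_rec: _ => [|i x _ hx].
  exact: ideal_span0.
by apply: ideal_spanMD => //; apply: h.
Qed.

(** The monomials in the support of an element of a monomial ideal belong to it. *)
Lemma mon_span_dvd (A : set (polyS k)) (L : set (monom posidx)) f M :
  (forall a, A a -> exists2 m, L m & a = << m >>) -> ideal_span A f ->
  M \in msupp f -> exists2 m, L m & mon_dvd m M.
Proof.
move=> hA [n [a [b [hb ->]]]]; elim/big_rec: _ => [|i x _ IH]; first by rewrite msupp0.
move=> /(fsubsetP (msuppD_le _ _)); rewrite in_fsetU => /orP[|/IH //].
case: (hA _ (hb i)) => m Lm ->.
case/msuppM_le => m1 [m2 [_ /(fsubsetP msuppU_le)]]; rewrite in_fset1 => /eqP -> ->.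
by exists m => //; exists m1; rewrite mulmC.
Qed.

Definition ell_gens : set (polyS k) := [set << ell n >> | n in [set n | (2 <= n)%N]].

Lemma in_ideal_ell : in_ideal I = ideal_span ell_gens.
Proof.
apply/seteqP; split; apply: ideal_spanS => f.
  case=> h [Ih h0] <-; have [[m n] [/= n2 ->]] := lm_ell hc char_k Ih h0.
  rewrite -malgUM -[_ * _]addr0; apply: ideal_spanMD; last exact: ideal_span0.
  by apply: mem_ideal_span; exists n.
case=> n /= n2 <-; apply: mem_ideal_span; exists (gmonic n); last by rewrite lm_gmonic.
by split; [exact: ideal_gmonic | exact: gmonic_neq0].
Qed.

Lemma lm_calG : [set << lm f >> | f in calG c] = ell_gens.
Proof.
apply/seteqP; split=> f.
  by case=> h /calGP[n n2 ->] <-; exists n; rewrite ?lm_gmonic.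
case=> n /= n2 <-; exists (gmonic n); last by rewrite lm_gmonic.
by apply/calGP; exists n.
Qed.

Lemma ell_gensE : ell_gens = [set x_ k m ^+ 2 | m in [set m | (1 <= m)%N]]
                  `|` [set x_ k m * x_ k m.+1 | m in [set m | (1 <= m)%N]].
Proof.
have x2 (m : nat) : (0 < m)%N -> x_ k m ^+ 2 = << ell (2 * m) >>.
  move=> m0; rewrite pvar_xmon // expr2 malgUM /ell.
  by rewrite (_ : (2 * m)./2 = m)%N 1?(_ : uphalf (2 * m) = m)%N //; lia.
have xx (m : nat) : (0 < m)%N -> x_ k m * x_ k m.+1 = << ell (2 * m + 1) >>.
  move=> m0; rewrite pvar_xmon // (@pvar_xmon k m.+1) // malgUM /ell.
  by rewrite (_ : (2 * m + 1)./2 = m)%N 1?(_ : uphalf (2 * m + 1) = m.+1)%N //; lia.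
apply/seteqP; split=> f.
  case=> n /= n2 <-; have [on|en] := boolP (odd n).
    right; exists n./2; first by rewrite /=; lia.
    by rewrite xx; [congr (<< ell _ >>) | ]; lia.
  left; exists n./2; first by rewrite /=; lia.
  by rewrite x2; [congr (<< ell _ >>) | ]; lia.
case=> -[m /= m1 <-]; rewrite ?x2 ?xx //.
  by exists (2 * m)%N => //=; lia.
by exists (2 * m + 1)%N => //=; lia.
Qed.

Lemma calG_reduced_groebner : reduced_groebner_basis I (calG c).
Proof.
split.
- split; last by rewrite lm_calG in_ideal_ell.
  by move=> f /calGP[n n2 ->]; split; [exact: ideal_gmonic | exact: gmonic_neq0].
- by move=> f /calGP[n n2 ->]; rewrite lm_gmonic // gmonic_coeff.
move=> f h /calGP[n n2 ->] /calGP[n' n2' ->] ne m hm; rewrite (lm_gmonic n2').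
move=> /(gmonic_dvd n2 n2' hm)[e _]; apply: ne.
by apply: (congr1 gmonic).
Qed.

Lemma mon_dvd_anti m m' : mon_dvd m m' -> mon_dvd m' m -> m = m'.
Proof.
move=> [d ->] [e]; have [d1 _|d1] := eqVneq (wt d) 0%N.
  by rewrite (wt_eq0 d1) mulm1.
by move=> /(congr1 (@wt _)); rewrite !wtM; move/eqP: d1; lia.
Qed.

Lemma mon_dvd_trans m m' m'' : mon_dvd m m' -> mon_dvd m' m'' -> mon_dvd m m''.
Proof. by move=> [d ->] [e ->]; exists (mmul d e); rewrite mulmA. Qed.

(** In another reduced basis [B], divisibility both ways gives each [b] the leading
    monomial [ell n] of some [gmonic n]. If [b - gmonic n] were nonzero, its leading
    monomial would be divisible by a leading monomial of each basis and would lie in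
    the support of [b] or of [gmonic n], against reducedness. *)
Lemma reduced_unique B : reduced_groebner_basis I B -> B = calG c.
Proof.
case=> -[BI eB] Bm Br.
have div f : I f -> f != 0 -> exists2 b, B b & mon_dvd (lm b) (lm f).
  move=> If f0; have : in_ideal I << lm f >> by apply: mem_ideal_span; exists f.
  rewrite eB => h.
  have lmf : lm f \in msupp (<< lm f >> : polyS k) by rewrite msuppU1 in_fset1.
  have mono (a : polyS k) : [set << lm b >> | b in B] a ->
      exists2 m, [set lm b | b in B] m & a = << m >>.
    by move=> [b Bb <-]; exists (lm b) => //; exists b.
  have [_ [b Bb <-] hd] := mon_span_dvd mono h lmf.
  by exists b.
have divB b f m : B b -> I f -> f != 0 -> mon_dvd (lm f) m -> m \in msupp b ->
    mon_dvd (lm b) m.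
  move=> Bb If f0 hd hm; have [b' Bb' hb'] := div f If f0.
  have := mon_dvd_trans hb' hd => hd'.
  by have [<- //|ne] := pselect (b' = b); case: (Br b b' Bb Bb' ne m hm).
have Bsub b : B b -> exists2 n, (2 <= n)%N & b = gmonic n.
  move=> Bb; have [Ib b0] := BI _ Bb; have [lb lbmax] := lmP b0.
  have [[m n] [/= n2 elb]] := lm_ell hc char_k Ib b0.
  have hb : lm b = ell n.
    have [b' Bb' hb'] := div _ (ideal_gmonic n2) (gmonic_neq0 n2).
    rewrite lm_gmonic // in hb'.
    have nb : mon_dvd (ell n) (lm b) by exists m; rewrite elb mulmC.
    have hd := mon_dvd_trans hb' nb.
    have [eb|ne] := pselect (b' = b); last by case: (Br b b' Bb Bb' ne _ lb).
    by rewrite eb in hb'; exact: mon_dvd_anti.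
  exists n => //; apply/eqP; rewrite -subr_eq0; apply: contrapT => /negP h0.
  have Ih : I (b - gmonic n) by apply: idealB => //; exact: ideal_gmonic.
  have [lh _] := lmP h0; have [[m' n'] [/= n2' elh]] := lm_ell hc char_k Ih h0.
  have nlh : lm (b - gmonic n) <> ell n.
    move=> e; move: lh; rewrite e -mcoeff_neq0 mcoeffB gmonic_coeff //.
    by rewrite -hb Bm // subrr eqxx.
  move: (lh) => /(fsubsetP (msuppB_le _ _)); rewrite in_fsetU => /orP[lhb|lhg].
    have [d ed] := divB b _ _ Bb Ih h0 (ex_intro _ mone (esym (mulm1 _))) lhb.
    apply: nlh; rewrite ed hb (_ : d = mone) ?mulm1 //; apply: wt_eq0.
    have := lbmax _ lhb; rewrite ed => -[|[r [_ [|[]|[]]]]].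
    - by move/(congr1 (@wt _)); rewrite wtM; lia.
    - by rewrite wtM; lia.
    - by rewrite wtM; lia.
    by rewrite wtM; lia.
  apply: nlh; apply: proj2 (gmonic_dvd n2 n2' lhg _).
  by exists m'; rewrite elh mulmC.
apply/seteqP; split=> f; first by move/Bsub => h; apply/calGP.
case/calGP=> n n2 ->; have [b Bb] := div _ (ideal_gmonic n2) (gmonic_neq0 n2).
rewrite (lm_gmonic n2); have [n' n2' eb] := Bsub b Bb.
have -> : lm b = ell n' by rewrite eb (lm_gmonic n2').
move=> hd.
have hn : ell n \in msupp (gmonic n) by rewrite -mcoeff_neq0 gmonic_coeff ?oner_neq0.
have [<- _] := gmonic_dvd n2 n2' hn hd.
by rewrite -eb.
Qed.
End GroebnerBasis.

(** * Elimination of the variables indexed by D *)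

Section PolynomialMorphisms.
Variables (k : fieldType) (P : {pred nat}).

(** A polynomial algebra is generated by its variables. *)
Lemma malg_morph_ext (B : comAlgType k) (F G : {rmorphism {malg k[monom P]} -> B}) :
  scalable F -> scalable G -> (forall i, F << ucm i >> = G << ucm i >>) -> F =1 G.
Proof.
move=> FZ GZ FG f; rewrite (malgZE f) !rmorph_sum; apply: eq_bigr => m _.
rewrite FZ GZ; congr (_ *: _); move: {2}(mdeg m) (leqnn (mdeg m)) => N.
elim: N m => [|N IH] m hN.
  have -> : m = mone by apply: mdeg_eq0I; lia.
  by rewrite !rmorph1.
have [->|m1] := eqVneq m mone; first by rewrite !rmorph1.
have [i hi] : exists i, i \in finsupp m.
  apply: contrapT => h; case/eqP: m1; apply/eqP/cmP => i; rewrite cm1.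
  by apply/eqP; rewrite cmE_eq0; apply/negP => hi; apply: h; exists i.
have em : m = mmul (ucm i) (divcm m (ucm i)).
  apply/eqP/cmP => j; rewrite cmM divcmE !cmU; case: eqP => [<-|_] /=.
    by rewrite subnKC // lt0n cmE_neq0.
  by rewrite subn0.
have eU : << m >> = << ucm i >> * << divcm m (ucm i) >> :> {malg k[monom P]}.
  by rewrite malgM_def fgmulUU mulr1 -em.
have hd : (mdeg (divcm m (ucm i)) <= N)%N by move: hN; rewrite {1}em mdegM mdegU.
have split_m (H : {rmorphism {malg k[monom P]} -> B}) :
    H << m >> = H << ucm i >> * H << divcm m (ucm i) >>.
  by rewrite -rmorphM; exact: (congr1 H eU).
rewrite (split_m F) (split_m G); congr (_ * _); first exact: FG.
exact: IH hd.
Qed.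

Lemma pvar_val (i : varidx P) : pvar P k (val i) = << ucm i >>.
Proof. by rewrite /pvar valK. Qed.

Lemma filt1 (P' : {pred nat}) : @filt P' k 0 0 1.
Proof. by move=> m; rewrite msuppU1 in_fset1 => /eqP ->; rewrite wt1. Qed.

Lemma filt_pvar n : @filt P k n 0 (pvar P k n).
Proof.
rewrite /pvar; case: insubP => [i _ <-|_]; last exact: filt0.
by rewrite -(wtU i); exact: filtW (@filtU _ _ _ _).
Qed.

Lemma filt_peval (P' : {pred nat}) (v : varidx P -> {malg k[monom P']}) d f :
  (forall i, filt (val i) 0 (v i)) -> filt d 0 f -> filt d 0 (peval v f).
Proof.
move=> hv hf; rewrite (malgZE f) raddf_sum big_seq_cond.
apply: filt_sum => m; rewrite andbT => /hf[<- _].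
rewrite /= linearZ /=; apply: filtZ; rewrite /peval mmapU /= scale1r mul1r.
rewrite /mon_eval /wt; elim: (finsupp m : seq _) => [|i s IH].
  by rewrite !big_nil; exact: filt1.
rewrite !big_cons; apply: (@filtM _ _ _ 0 _ 0) => //.
elim: (m i) => [|n IHn]; first by rewrite muln0 expr0; exact: filt1.
by rewrite exprS mulnS; apply: (@filtM _ _ _ 0 _ 0).
Qed.
End PolynomialMorphisms.

Section Elimination.
Variables (k : fieldType) (c : k).
Local Notation g := (g_ c).

(** The quadratic part of [g_n] in an arbitrary sequence of elements of an algebra. *)
Definition quad (B : comAlgType k) (u : nat -> B) (n : nat) : B :=
  \sum_(1 <= i < n | (2 * i < n)%N) s_ c (n - 2 * i)%N *: (u i * u (n - i)%N)
  + (if (2 %| n)%N then u (n %/ 2)%N ^+ 2 else 0).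

Lemma g_quad n : g n = (s_ c n - c) *: x_ k n + quad (pvar posidx k) n.
Proof. by rewrite /g_ /quad addrA. Qed.

Lemma quad_morph (A B : comAlgType k) (F : {rmorphism A -> B}) (u : nat -> A) n :
  scalable F -> F (quad u n) = quad (fun i => F (u i)) n.
Proof.
move=> FZ; rewrite /quad rmorphD rmorph_sum; congr (_ + _).
  by apply: eq_bigr => i _; rewrite FZ rmorphM.
by case: ifP => _; rewrite ?rmorphXn ?rmorph0.
Qed.

Lemma quad_ext (B : comAlgType k) (u u' : nat -> B) n : (0 < n)%N ->
  (forall i, (0 < i < n)%N -> u i = u' i) -> quad u n = quad u' n.
Proof.
move=> n0 h; rewrite /quad; congr (_ + _).
  rewrite big_nat_cond [RHS]big_nat_cond; apply: eq_bigr => i hi.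
  by rewrite !h //; lia.
by case: ifP => // /dvdnP[m e]; rewrite h //; lia.
Qed.

Definition elim_step (u : nat -> polyT k) (n : nat) : polyT k :=
  if n \in Aidx then y_ k n else - (s_ c n - c)^-1 *: quad u n.

(** Course-of-values recursion: the list of the first [n] values of the solution. *)
Fixpoint elim_seq n : seq (polyT k) :=
  if n is n'.+1 then rcons (elim_seq n') (elim_step (nth 0 (elim_seq n')) n')
  else [::].

(** The expression of [x_n] through the variables indexed by [A]. The list is
    always read inside its length, see [nth_elim_seq]. *)
Definition elim_var n : polyT k := nth 0 (elim_seq n.+1) n.

Lemma size_elim_seq n : size (elim_seq n) = n.
Proof. by elim: n => //= n IH; rewrite size_rcons IH. Qed.

Lemma nth_elim_seq n i : (i < n)%N -> nth 0 (elim_seq n) i = elim_var i.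
Proof.
elim: n => // n IH; rewrite ltnS leq_eqVlt => /orP[/eqP -> //|lt] /=.
by rewrite nth_rcons size_elim_seq lt IH.
Qed.

Lemma elim_varE n : (0 < n)%N -> elim_var n = elim_step elim_var n.
Proof.
move=> n0; rewrite {1}/elim_var /= nth_rcons size_elim_seq ltnn eqxx /elim_step.
have e : quad (nth 0 (elim_seq n)) n = quad elim_var n.
  apply: quad_ext; first exact: n0.
  by move=> i /andP[_ lt]; exact: nth_elim_seq.
case: (n \in Aidx); first by [].
exact: (congr1 (fun x => - (s_ c n - c)^-1 *: x) e).
Qed.

Lemma notA_D n : (0 < n)%N -> n \notin Aidx -> n \in Didx.
Proof. by move=> n0; rewrite !inE; lia. Qed.

Lemma D_notA n : n \in Didx -> n \notin Aidx.
Proof. by rewrite !inE; lia. Qed.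

Definition S_to_T : polyS k -> polyT k :=
  peval (fun i : varidx posidx => elim_var (val i)).
HB.instance Definition _ := GRing.LRMorphism.on S_to_T.

Definition T_to_S : polyT k -> polyS k :=
  peval (fun i : varidx Aidx => x_ k (val i)).
HB.instance Definition _ := GRing.LRMorphism.on T_to_S.

Lemma S_to_T_scalable : scalable S_to_T.
Proof. exact: peval_scalable. Qed.

Lemma T_to_S_scalable : scalable T_to_S.
Proof. exact: peval_scalable. Qed.

Lemma S_to_T_x n : (0 < n)%N -> S_to_T (x_ k n) = elim_var n.
Proof.
by move=> n0; rewrite -[n]/(val (Sub n n0 : varidx posidx)) /S_to_T peval_var.
Qed.

Hypotheses (hc : c ^+ 2 + c = 1) (char_k : 5%N \notin [pchar k]).

(** [s_n - c] is [2 - c] or [-1 - 2c], and both divide 5. *)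
Lemma lin_coeff_neq0 n : n \in Didx -> s_ c n - c != 0.
Proof.
have h := c_sq hc; rewrite !inE => /andP[_ hn].
apply/eqP => e0; case/negP: char_k; rewrite inE /=; apply/eqP; move: e0.
rewrite -s_mod5; case/or3P: hn => /eqP ->; rewrite /s_ /= => e0.
- have e : (5%:R : k) = (3 + c) * (2 - c) by ring: h.
  by rewrite e e0 mulr0.
- have e : (5%:R : k) = (-1 - c - c) ^+ 2 by ring: h.
  by rewrite e e0 expr0n.
have e : (5%:R : k) = (-1 - c - c) ^+ 2 by ring: h.
by rewrite e e0 expr0n.
Qed.

Lemma S_to_T_g n : n \in Didx -> S_to_T (g n) = 0.
Proof.
move=> nD; have n0 : (0 < n)%N by move: nD; rewrite !inE; lia.
have e1 : (s_ c n - c) *: S_to_T (x_ k n) = - quad elim_var n.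
  rewrite (S_to_T_x n0) (elim_varE n0) /elim_step (negPf (D_notA nD)) scalerA.
  by rewrite mulrN divff ?lin_coeff_neq0 // scaleN1r.
have e2 : S_to_T (quad (pvar posidx k) n) = quad elim_var n.
  rewrite (quad_morph _ _ S_to_T_scalable); apply: quad_ext; first exact: n0.
  by move=> i /andP[i0 _]; exact: S_to_T_x.
rewrite g_quad rmorphD /= S_to_T_scalable.
exact: etrans (congr2 +%R e1 e2) (addNr _).
Qed.

Lemma S_to_T_ideal f : ideal_I c f -> S_to_T f = 0.
Proof.
case=> n [a [h [hG ->]]]; rewrite rmorph_sum big1 // => i _.
by case: (hG i) => d /S_to_T_g hd <-; rewrite rmorphM /= hd mulr0.
Qed.
End Elimination.

(** * The presentation of the quotient algebra *)

Section Isomorphism.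
Variables (k : fieldType) (c : k).
Hypotheses (hc : c ^+ 2 + c = 1) (char_k : 5%N \notin [pchar k]).
Local Notation g := (g_ c).
Local Notation S_to_T := (S_to_T c).
Local Notation quot_cls := (quot_cls c).
Local Notation T_to_S := (@T_to_S k).
Local Notation elim_var := (elim_var c).

HB.instance Definition _ := GRing.RMorphism.copy quot_cls
  (\pi_{ideal_quot (ideal_Ib c)}%qT).

Lemma quot_cls_scalable : scalable quot_cls.
Proof. exact: pi_scalable. Qed.

Lemma quot_cls_eq f f' : ideal_I c (f - f') -> quot_cls f = quot_cls f'.
Proof.
move=> h; apply/eqP; rewrite -Quotient.idealrBE; exact/asboolP.
Qed.

Lemma eq_quot_cls f f' : quot_cls f = quot_cls f' -> ideal_I c (f - f').
Proof.
move/eqP; rewrite -Quotient.idealrBE => h; exact/asboolP.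
Qed.

Lemma theta_scalable : scalable (theta c).
Proof. exact: peval_scalable. Qed.

Lemma theta_y n : n \in Aidx -> theta c (y_ k n) = quot_cls (x_ k n).
Proof.
by move=> nA; rewrite -[n]/(val (Sub n nA : varidx Aidx)) /theta peval_var.
Qed.

(** The relations [g_n = 0] hold in the quotient and determine the class of [x_n] from
    the previous ones, exactly as [elim_var n] is computed. *)
Lemma quot_cls_elim n : (0 < n)%N -> theta c (elim_var n) = quot_cls (x_ k n).
Proof.
elim/ltn_ind: n => n IH n0; rewrite (elim_varE c n0) /elim_step.
have [nA|nA] := boolP (n \in Aidx); first exact: theta_y.
have nD := notA_D n0 nA.
have e0 : quot_cls (g n) = 0.
  rewrite -[RHS](rmorph0 quot_cls); apply: quot_cls_eq; rewrite subr0.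
  by apply: mem_ideal_span; exists n.
rewrite g_quad rmorphD /= quot_cls_scalable (quad_morph _ _ _ quot_cls_scalable) in e0.
have e1 : theta c (quad c elim_var n) = quad c (fun i => quot_cls (x_ k i)) n.
  rewrite (quad_morph _ _ _ theta_scalable); apply: quad_ext; first exact: n0.
  by move=> i /andP[i0 lt]; exact: IH.
rewrite theta_scalable e1 scaleNr -scalerN.
have -> : - quad c (fun i => quot_cls (x_ k i)) n = (s_ c n - c) *: quot_cls (x_ k n).
  by apply/esym/eqP; rewrite -addr_eq0; apply/eqP.
by rewrite scalerA mulVf ?lin_coeff_neq0 // scale1r.
Qed.

Lemma theta_S_to_T f : theta c (S_to_T f) = quot_cls f.
Proof.
apply: (malg_morph_ext (F := theta c \o S_to_T) (G := quot_cls)) => [a u|a u|i] /=.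
- by rewrite S_to_T_scalable theta_scalable.
- exact: quot_cls_scalable.
by rewrite -pvar_val S_to_T_x ?quot_cls_elim //; exact: (valP i).
Qed.

Lemma theta_T_to_S t : theta c t = quot_cls (T_to_S t).
Proof.
apply: (malg_morph_ext (F := theta c) (G := quot_cls \o T_to_S)) => [a u|a u|i] /=.
- exact: theta_scalable.
- by rewrite T_to_S_scalable quot_cls_scalable.
by rewrite -pvar_val theta_y ?(valP i) // /T_to_S peval_var.
Qed.

Lemma S_to_T_to_S t : S_to_T (T_to_S t) = t.
Proof.
apply: (malg_morph_ext (F := S_to_T \o T_to_S) (G := idfun)) => [a u|//|i] /=.
  by rewrite T_to_S_scalable S_to_T_scalable.
rewrite -pvar_val /T_to_S peval_var.
have i0 : (0 < val i)%N by have := valP i; rewrite !inE; lia.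
by rewrite S_to_T_x // elim_varE // /elim_step (valP i).
Qed.

(** The inverse is induced by [S_to_T]: a representative of the class of [f] differs from
    [f] by an element of the ideal, which [S_to_T] kills. *)
Lemma theta_bij : bijective (theta c).
Proof.
have repr_quotK q : quot_cls (repr q) = q by exact: reprK.
exists (fun q => S_to_T (repr q)) => [t|q]; last by rewrite theta_S_to_T repr_quotK.
rewrite -[RHS]S_to_T_to_S; apply/eqP; rewrite -subr_eq0 -rmorphB; apply/eqP.
by apply: S_to_T_ideal => //; apply: eq_quot_cls; rewrite repr_quotK theta_T_to_S.
Qed.

Lemma elim_homog n : (0 < n)%N -> filt n 0 (elim_var n).
Proof.
elim/ltn_ind: n => n IH n0; rewrite (elim_varE c n0) /elim_step.
case: (n \in Aidx); first exact: filt_pvar.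
apply: filtZ; apply: filtD.
  rewrite big_nat_cond; apply: filt_sum => i hi; apply: filtZ.
  have e : (n = i + (n - i))%N by lia.
  by rewrite {1}e; apply: (@filtM _ _ _ 0 _ 0); apply: IH; lia.
case: (boolP (2 %| n)%N) => [/dvdnP[m e]|_]; last exact: filt0.
have e2 : (n %/ 2 = m)%N by rewrite e mulnK.
have em : n = (m + m)%N by lia.
by rewrite e2 expr2 {1}em; apply: (@filtM _ _ _ 0 _ 0); apply: IH; lia.
Qed.

Lemma theta_graded d : theta c @` (@homog Aidx k d) = @quot_homog k c d.
Proof.
apply/seteqP; split=> q.
  case=> t; rewrite -filt_homog => ht <-; exists (T_to_S t); last by rewrite theta_T_to_S.
  by rewrite -filt_homog; apply: filt_peval => // i; exact: filt_pvar.
case=> f; rewrite -filt_homog => hf <-; exists (S_to_T f); last by rewrite theta_S_to_T.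
by rewrite -filt_homog; apply: filt_peval => // i; apply: elim_homog; exact: (valP i).
Qed.
End Isomorphism.

Theorem theorem1p2 (k : fieldType) (c : k)
    (char_k : 5%N \notin [pchar k]) (hc : c ^+ 2 + c = 1) :
  [/\ (* (1) *)
      (forall n, n \in Aidx -> theta c (y_ k n) = quot_cls c (x_ k n))
      /\ graded_iso (@homog Aidx k) (@quot_homog k c)
           (theta c : {lrmorphism polyT k -> quotSI c}),
      (* (2) *)
      reduced_groebner_basis (ideal_I c) (calG c)
      /\ (forall B, reduced_groebner_basis (ideal_I c) B -> B = calG c)
    & (* (3) *)
      in_ideal (ideal_I c) =
      ideal_span ([set x_ k m ^+ 2 | m in [set m | (1 <= m)%N]]
                  `|` [set x_ k m * x_ k m.+1 | m in [set m | (1 <= m)%N]])].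
Proof.
split.
- split; first by move=> n nA; exact: theta_y.
  by split; [exact: theta_bij | exact: theta_graded].
- by split; [exact: calG_reduced_groebner | exact: reduced_unique].
by rewrite in_ideal_ell // ell_gensE.
Qed.
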